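(* Let $f_1,\ldots,f_{m+2}$ be SOS-convex semi-algebraic functions on $\mathbb{R}^n$ given with representations as in the context, such that $K:=\{x\in\mathbb{R}^n : f_i(x)\le 0,\ i=1,\ldots,m\}$ is nonempty and $f_{m+1}(x)\ge 0$, $-f_{m+2}(x)>0$ for all $x\in K$. Suppose that the convex cone $$\mathcal{C}:=\bigcup_{y^{i}\in\Omega_{i},\,\lambda_{i}\geq 0,\ i=1,\ldots,m}\mathrm{epi}\Big(\sum_{i=1}^m\lambda_{i}\Big(h_{0}^{i}+\sum_{j=1}^{s_{i}}y^{i}_{j}h^{i}_{j}\Big)\Big)^*\subseteq\mathbb{R}^n\times\mathbb{R}$$ is closed. Then $$\inf(\mathrm{FP})=\max(\widehat{\mathrm{Q}}),$$ that is, the infimum of the fractional program $(\mathrm{FP})$ equals the optimal value of the semidefinite program $(\widehat{\mathrm{Q}})$, and the latter is attained. Here $(\mathrm{FP})$ and $(\widehat{\mathrm{Q}})$ are the problems defined in the context.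
   Context: **Notation.** $\mathbb{N}$ is the set of non-negative integers. For $\alpha\in\mathbb{N}^n$, $|\alpha|=\sum_i\alpha_i$, $x^\alpha=x_1^{\alpha_1}\cdots x_n^{\alpha_n}$, and $\mathbb{N}^n_{k}=\{\alpha\in\mathbb{N}^n: |\alpha|\le k\}$. $s(k)=\binom{n+k}{n}$. $S^k$ is the space of real symmetric $k\times k$ matrices, $\langle X,Y\rangle=\mathrm{tr}(XY)$, and $X\succeq 0$ means $X$ is positive semidefinite. $v_d(x)=(x^\alpha)_{\alpha\in\mathbb{N}^n_d}$ is the column vector of monomials of degree at most $d$, and the matrices $\mathcal{B}_\alpha\in S^{s(d)}$, $\alpha\in\mathbb{N}^n_{2d}$, are defined by $v_d(x)v_d(x)^T=\sum_{\alpha\in\mathbb{N}^n_{2d}}x^\alpha\mathcal{B}_\alpha$. For a polynomial $h$ of degree at most $2d$, $(h)_\alpha$ is its coefficient of $x^\alpha$. For a function $\phi:\mathbb{R}^n\to\mathbb{R}\cup\{+\infty\}$, $\phi^*(x^* )=\sup_{x\in\mathbb{R}^n}\{\langle x^*,x\rangle-\phi(x)\}$ is its conjugate and $\mathrm{epi}\,\phi=\{(x,r)\in\mathbb{R}^n\times\mathbb{R}:\phi(x)\le r\}$ its epigraph. **SOS-convexity.** A real polynomial $f$ on $\mathbb{R}^n$ is SOS-convex if there is a matrix polynomial $F(x)$ with $\nabla^2 f(x)=F(x)F(x)^T$. **Data.** Let $I=\{1,\ldots,m+2\}$. For each $i\in I$, $$f_i(x)=\sup_{(y^i_1,\ldots,y^i_{s_i})\in\Omega_i}\Big\{h_0^i(x)+\sum_{j=1}^{s_i}y_j^ih_j^i(x)\Big\},$$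 where (a) each $h_j^i$, $j=0,\ldots,s_i$, is a polynomial on $\mathbb{R}^n$ of degree at most $2d$, and for each $y^i\in\Omega_i$ the polynomial $h_0^i+\sum_{j=1}^{s_i}y_j^ih_j^i$ is SOS-convex; (b) $\Omega_i$ is a nonempty compact set of the form $$\Omega_i=\Big\{(y_1^i,\ldots,y_{s_i}^i)\in\mathbb{R}^{s_i}:\exists z^i\in\mathbb{R}^{p_i}\ \text{s.t.}\ A_0^i+\sum_{j=1}^{s_i}y_j^iA_j^i+\sum_{\ell=1}^{p_i}z_\ell^iB_\ell^i\succeq 0\Big\},$$ with $A_j^i$, $j=0,\ldots,s_i$, and $B_\ell^i$, $\ell=1,\ldots,p_i$, symmetric $t_i\times t_i$ matrices. (Such functions $f_i$ are called SOS-convex semi-algebraic.) **Fractional program.** $$(\mathrm{FP})\qquad \inf_{x\in\mathbb{R}^n}\Big\{\frac{f_{m+1}(x)}{-f_{m+2}(x)} : f_i(x)\le 0,\ i=1,\ldots,m\Big\}.$$ **SDP relaxation dual problem.** $$(\widehat{\mathrm{Q}})\qquad \sup_{\lambda_j^i,\,z_\ell^i,\,X}\ \lambda_0^{m+2}$$ subject to $$\sum_{i=1}^{m+2}\Big(\lambda_0^i(h_0^i)_\alpha+\sum_{j=1}^{s_i}\lambda_j^i(h_j^i)_\alpha\Big)=\langle\mathcal{B}_\alpha,X\rangle,\quad \alpha\in\mathbb{N}^n_{2d},$$ $$\lambda_0^iA_0^i+\sum_{j=1}^{s_i}\lambda_j^iA_j^i+\sum_{\ell=1}^{p_i}z_\ell^iB_\ell^i\succeq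 0,\quad i=1,\ldots,m+2,$$ $$\lambda_0^{m+1}=1,\quad \lambda_0^i\ge 0\ (i=1,\ldots,m,m+2),\quad X\in S^{s(d)},\ X\succeq 0,$$ $$\lambda_j^i\in\mathbb{R},\ z_\ell^i\in\mathbb{R},\quad i\in I,\ j=1,\ldots,s_i,\ \ell=1,\ldots,p_i.$$ *)

(* Defs.v *)
From mathcomp Require Import all_boot all_order all_algebra.
From mathcomp Require Import all_classical all_reals all_analysis.
(* The notations of mpoly clash with those of mathcomp-analysis:
   mpoly n R is {mpoly R[n]}, mcoeff a p is p@_a, meval v p is p.@[v],
   multinom n is 'X_{1..n}, bmultinom n k is 'X_{1..n < k}. *)
From mathcomp Require Import -(notations) mpoly.

Set Implicit Arguments.
Unset Strict Implicit.
Unset Printing Implicit Defensive.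

Import Order.TTheory GRing.Theory Num.Theory.
Import numFieldNormedType.Exports.

Local Open Scope classical_set_scope.
Local Open Scope ring_scope.

Definition psd (R : realType) (k : nat) (X : 'M[R]_k) : Prop :=
  X^T = X /\ forall v : 'cV[R]_k, 0 <= (v^T *m X *m v) 0 0.

Definition dotp (R : realType) (n : nat) (u v : 'rV[R]_n) : R :=
  \sum_(i < n) u 0 i * v 0 i.

Definition evalp (R : realType) (n : nat) (f : mpoly n R) (x : 'rV[R]_n) : R :=
  meval (fun i => x 0 i) f.

(* msize is the degree plus one, and 0 for the zero polynomial. *)
Definition deg_le (R : realType) (n k : nat) (f : mpoly n R) : Prop :=
  (msize f <= k.+1)%N.

Definition hessian (R : realType) (n : nat) (f : mpoly n R)
    : 'M[mpoly n R]_n :=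
  \matrix_(i, j) mderiv j (mderiv i f).

Definition sos_convex (R : realType) (n : nat) (f : mpoly n R) : Prop :=
  exists (q : nat) (F : 'M[mpoly n R]_(n, q)), hessian f = F *m F^T.

Definition conjugate (R : realType) (n : nat) (phi : 'rV[R]_n -> \bar R)
    (xs : 'rV[R]_n) : \bar R :=
  ereal_sup [set ((dotp xs x)%:E - phi x)%E | x in [set: 'rV[R]_n]].

Definition epi (R : realType) (n : nat) (phi : 'rV[R]_n -> \bar R)
    : set ('rV[R]_n * R) :=
  [set p | (phi p.1 <= p.2%:E)%E].

(* The monomials of degree at most d, in the enumeration order of the finite
   type 'X_{1..n < d.+1}, whose cardinal is 'C(n + d, n). *)
Definition nmon (n d : nat) : nat := #|{: bmultinom n d.+1}|.

Definition vmon (R : realType) (n d : nat) : 'cV[mpoly n R]_(nmon n d) :=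
  \col_i mpolyX R (bmnm (enum_val i)).

(* The coefficient of x^a in the matrix polynomial v_d(x) v_d(x)^T. *)
Definition Bmat (R : realType) (n d : nat) (a : multinom n)
    : 'M[R]_(nmon n d) :=
  map_mx (mcoeff a) (vmon R n d *m (vmon R n d)^T).

Lemma vmon_outer (R : realType) (n d : nat) :
  vmon R n d *m (vmon R n d)^T =
  \matrix_(i, j) \sum_(a : bmultinom n (d * 2).+1)
    Bmat R d (bmnm a) i j *: mpolyX R (bmnm a).
Proof.
apply/matrixP => i j; rewrite [RHS]mxE.
set p := (vmon R n d *m _) i j.
have hp : (msize p <= (d * 2).+1)%N.
  rewrite /p !mxE big_ord1 !mxE -mpolyXD msizeX mdegD ltnS muln2 -addnn.
  by apply: leq_add; rewrite -ltnS bmdeg.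
rewrite [LHS](mpolywE hp); apply: eq_bigr => a _.
by rewrite [Bmat _ _ _ _ _]mxE.
Qed.

(* The data of a function
     f(x) = sup_{y in Omega} h_0(x) + \sum_j y_j h_j(x),
   Omega = {y | exists z, A_0 + \sum_j y_j A_j + \sum_l z_l B_l psd}. *)
Record sup_data (R : realType) (n : nat) := SupData {
  sd_s : nat;
  sd_p : nat;
  sd_t : nat;
  sd_h0 : mpoly n R;
  sd_h : 'I_sd_s -> mpoly n R;
  sd_A0 : 'M[R]_sd_t;
  sd_A : 'I_sd_s -> 'M[R]_sd_t;
  sd_B : 'I_sd_p -> 'M[R]_sd_t
}.
Arguments sd_h {R n} D : rename.
Arguments sd_A {R n} D : rename.
Arguments sd_B {R n} D : rename.

Definition hpoly (R : realType) (n : nat) (D : sup_data R n)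
    (y : 'rV[R]_(sd_s D)) : mpoly n R :=
  sd_h0 D + \sum_(j < sd_s D) y 0 j *: sd_h D j.
Arguments hpoly {R n} D y.

Definition Omega (R : realType) (n : nat) (D : sup_data R n)
    : set 'rV[R]_(sd_s D) :=
  [set y | exists z : 'rV[R]_(sd_p D),
     psd (sd_A0 D + \sum_(j < sd_s D) y 0 j *: sd_A D j
                  + \sum_(l < sd_p D) z 0 l *: sd_B D l)].
Arguments Omega {R n} D.

(* A genuine supremum (indeed a maximum) as soon as Omega is nonempty and
   compact. *)
Definition supfun (R : realType) (n : nat) (D : sup_data R n)
    (x : 'rV[R]_n) : R :=
  sup [set evalp (hpoly D y) x | y in Omega D].

Definition sos_convex_semialg (R : realType) (n d : nat) (D : sup_data R n)
    : Prop :=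
  [/\ deg_le (2 * d) (sd_h0 D) /\ (forall j, deg_le (2 * d) (sd_h D j)),
      forall y, Omega D y -> sos_convex (hpoly D y),
      Omega D !=set0 /\ compact (Omega D) &
      [/\ (sd_A0 D)^T = sd_A0 D,
          forall j, (sd_A D j)^T = sd_A D j &
          forall l, (sd_B D l)^T = sd_B D l]].

(* The functions f_1, ..., f_{m+2} are indexed by 'I_(m + 2). *)
Definition idx_con (m : nat) (i : 'I_m) : 'I_(m + 2) := lshift 2 i.
Definition idx_num (m : nat) : 'I_(m + 2) := rshift m (0 : 'I_2).
Definition idx_den (m : nat) : 'I_(m + 2) := rshift m (1 : 'I_2).

Section FractionalProgram.
Variables (R : realType) (n m : nat) (D : 'I_(m + 2) -> sup_data R n).

Definition FPset : set 'rV[R]_n :=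
  [set x | forall i : 'I_m, supfun (D (idx_con i)) x <= 0].

Definition FPval : set R :=
  [set supfun (D (idx_num m)) x / - supfun (D (idx_den m)) x | x in FPset].

Definition epi_cone : set ('rV[R]_n * R) :=
  [set p | exists (lam : 'I_m -> R)
                  (y : forall i : 'I_m, 'rV[R]_(sd_s (D (idx_con i)))),
    (forall i, 0 <= lam i /\ Omega (D (idx_con i)) (y i)) /\
    epi (conjugate
      (fun x => (evalp (\sum_(i < m) lam i *: hpoly (D (idx_con i)) (y i)) x)%:E)) p].

Definition Qfeasible (d : nat) (lam0 : 'I_(m + 2) -> R)
    (lam : forall i, 'rV[R]_(sd_s (D i))) (z : forall i, 'rV[R]_(sd_p (D i)))
    (X : 'M[R]_(nmon n d)) : Prop :=
  [/\ forall a : multinom n, (mdeg a <= 2 * d)%N ->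
        \sum_(i < m + 2)
          (lam0 i * mcoeff a (sd_h0 (D i))
           + \sum_(j < sd_s (D i)) lam i 0 j * mcoeff a (sd_h (D i) j))
        = \tr (Bmat R d a *m X),
      forall i : 'I_(m + 2),
        psd (lam0 i *: sd_A0 (D i)
             + \sum_(j < sd_s (D i)) lam i 0 j *: sd_A (D i) j
             + \sum_(l < sd_p (D i)) z i 0 l *: sd_B (D i) l),
      lam0 (idx_num m) = 1,
      (forall i : 'I_m, 0 <= lam0 (idx_con i)) /\ 0 <= lam0 (idx_den m) &
      psd X].

Definition Qval (d : nat) : set R :=
  [set v | exists lam0 lam z X, @Qfeasible d lam0 lam z X /\ v = lam0 (idx_den m)].

End FractionalProgram.

(* Main.v *)
(** Taylor's formula with integral remainder writes an SOS-convex [f] of degree at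
most [2d] as its affine part at [u] plus a polynomial with a positive
semidefinite Gram matrix; integrating a square along the segment from [u] to
[x] costs only the positive semidefinite kernel [1/((a+b+1)(a+b+2))]. A
nonnegative SOS-convex [f] is therefore a sum of squares: [f + e |x|^2] is
coercive, its remainder at a minimiser has no linear part, and the Gram cone is
closed, so [e] can tend to 0.

Let [rho] be the infimum of (FP). The convex function [f_{m+1} + rho f_{m+2}]
is nonnegative on [K]. With [E] the union of the epigraphs of the conjugates of
[h_y^{m+1} + rho h_{y'}^{m+2}], the set [C + E] contains the origin: its point
nearest to the origin exists because [C] is closed and [Omega] compact, and
otherwise separates the origin from [C + E], which produces a point of [K] where
[f_{m+1} + rho f_{m+2}] is negative. So some Lagrangian is nonnegative on the
whole space; being SOS-convex it is a sum of squares, and its Gram matrix makes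
[rho] feasible for the dual. Weak duality holds because recession directions of
the compact sets [Omega_i] vanish, so a zero multiplier kills its whole block. *)
Require Import Defs.
From mathcomp Require Import all_boot all_order all_algebra.
From mathcomp Require Import all_classical all_reals all_analysis.
From mathcomp Require Import -(notations) mpoly.
From mathcomp Require Import polyrcf ring lra zify.
Import Order.TTheory GRing.Theory Num.Theory.
Import numFieldNormedType.Exports.
Set Implicit Arguments.
Unset Strict Implicit.
Unset Printing Implicit Defensive.
Local Open Scope classical_set_scope.
Local Open Scope ring_scope.

(** * Multivariate polynomials along lines *)

Section Lines.
Variable R : realType.

(** Evaluation and substitution are ring morphisms, so identities about them need checking only on
    constants and variables. *)
Lemma mpoly_gen_ind (n : nat) (P : mpoly n R -> Prop) :
  (forall c, P (mpolyC n c)) -> (forall i, P (mpolyX R (mnm1 i))) ->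
  (forall p q, P p -> P q -> P (p + q)) ->
  (forall p q, P p -> P q -> P (p * q)) -> forall p, P p.
Proof.
move=> PC PX PD PM p; rewrite (mpolyE p).
apply: (big_ind P) => [||m _]; [by rewrite -(mpolyC0 n R); exact: PC|exact: PD|].
rewrite -mul_mpolyC; apply: (PM) => //.
rewrite mpolyXE_id; apply: (big_ind P) => [||i _]; [by rewrite -mpolyC1|exact: PM|].
elim: (m i) => [|k ih]; first by rewrite expr0 -mpolyC1.
by rewrite exprS; exact: PM.
Qed.

(** The restriction of [f] to the line [u + t *: w], kept as a univariate polynomial in [t] so that
    root counting, formal derivatives and the mean value theorem apply. *)
Definition line_poly (n : nat) (u w : 'rV[R]_n) (f : mpoly n R) : {poly R} :=
  mmap polyC (fun i => (u 0 i)%:P + w 0 i *: 'X) f.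

Lemma horner_line_poly (n : nat) (u w : 'rV[R]_n) (f : mpoly n R) t :
  (line_poly u w f).[t] = evalp f (u + t *: w).
Proof.
rewrite /line_poly /evalp; elim/mpoly_gen_ind: f => [c|i|p q hp hq|p q hp hq].
- by rewrite mmapC mevalC hornerC.
- by rewrite mmapX mmap1U mevalXU !hornerE !mxE mulrC.
- by rewrite mmapD mevalD hornerD hp hq.
- by rewrite rmorphM mevalM hornerM hp hq.
Qed.

Lemma deriv_line_poly (n : nat) (u w : 'rV[R]_n) (f : mpoly n R) :
  (line_poly u w f)^`() = \sum_i w 0 i *: line_poly u w (mderiv i f).
Proof.
rewrite /line_poly; elim/mpoly_gen_ind: f => [c|k|p q hp hq|p q hp hq].
- by rewrite mmapC derivC big1 // => i _; rewrite mderivC mmap0 scaler0.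
- rewrite mmapX mmap1U derivD derivC add0r derivZ derivX (bigD1 k) //=.
  rewrite big1 => [|i /negPf ik]; rewrite mderivX mnm1E.
    rewrite eqxx scale1r addr0; have -> : mnm_sub (mnm1 k) (mnm1 k) = mnm0.
      by apply/mnmP => j; rewrite mnmBE subnn mnm0E.
    by rewrite mpolyX0 rmorph1.
  by rewrite eq_sym ik scale0r mmap0 scaler0.
- rewrite mmapD derivD hp hq -big_split; apply: eq_bigr => i _.
  by rewrite mderivD mmapD scalerDr.
- rewrite rmorphM derivM hp hq mulr_suml mulr_sumr -big_split.
  apply: eq_bigr => i _; rewrite mderivM mmapD !rmorphM scalerDr.
  by rewrite /= scalerAl scalerAr.
Qed.

Lemma evalp0 (n : nat) (p : mpoly n R) : evalp p 0 = mcoeff mnm0 p.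
Proof.
rewrite /evalp; elim/mpoly_gen_ind: p => [c|i|p q hp hq|p q hp hq].
- by rewrite mevalC mcoeffC eqxx mulr1.
- by rewrite mevalXU mxE mcoeffX mnm1_eq0.
- by rewrite mevalD mcoeffD hp hq.
- by rewrite mevalM hp hq rmorphM.
Qed.

(* The directional derivatives of a vanishing polynomial vanish, so all its
   Taylor coefficients do. *)
Lemma evalp_inj (n : nat) (p q : mpoly n R) : evalp p =1 evalp q -> p = q.
Proof.
move=> pq; apply/mpolyP => m; apply/eqP; rewrite -subr_eq0 -mcoeffB; apply/eqP.
have : forall x, evalp (p - q) x = 0 by move=> x; rewrite /evalp mevalB [X in X - _]pq subrr.
move: (p - q) => {pq}{}p; elim: {m}(mdeg m) {-2}m (erefl (mdeg m)) p => [|k ih] m.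
  by move/eqP; rewrite mdeg_eq0 => /eqP -> p /(_ 0); rewrite evalp0.
move=> mk p p0.
have [i mi] : exists i, lem (mnm1 i) m.
  have /existsP[i mi] : [exists i, m i != 0%N].
    apply: contraT => /existsPn h; move: mk; rewrite mdegE big1 // => i _.
    by apply/eqP; have := h i; rewrite negbK.
  by exists i; rewrite lep1mP.
have dp x : evalp (mderiv i p) x = 0.
  have l0 : line_poly x (delta_mx 0 i) p = 0.
    (* The integers from 0 to the size of the restriction are more roots than its degree allows. *)
    apply: (@roots_geq_poly_eq0 _ _
      [seq j%:R | j <- iota 0 (size (line_poly x (delta_mx 0 i) p)).+1]).
    - by apply/allP => t _; rewrite rootE horner_line_poly p0.
    - by rewrite map_inj_uniq ?iota_uniq // => a b /eqP; rewrite eqr_nat => /eqP.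
    - by rewrite size_map size_iota.
  have := deriv_line_poly x (delta_mx 0 i) p; rewrite l0 deriv0 (bigD1 i) //= big1.
    rewrite mxE !eqxx scale1r addr0 => /(congr1 (horner^~ 0)); rewrite horner0.
    by rewrite horner_line_poly scale0r addr0.
  by move=> j /negPf ji; rewrite mxE ji andbF scale0r.
have mk' : mdeg (mnm_sub m (mnm1 i)) = k.
  by have := congr1 (@mdeg n) (submK mi); rewrite mdegD mdeg1 mk addn1 => -[].
have /eqP := ih _ mk' _ dp.
by rewrite mcoeff_mderiv submK // mulrn_eq0 => /eqP.
Qed.

End Lines.

(** * The integral form of the second-order Taylor remainder *)

Section Remainder.
Variable R : realType.

(* [\int_0^1 (1 - t) t^k dt] *)
Definition beta_coef (k : nat) : R := (k.+1%:R * k.+2%:R)^-1.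

Lemma beta_coefK (k : nat) (x : R) : beta_coef k * (x *+ (k.+2 * k.+1)) = x.
Proof.
by rewrite -mulr_natr natrM [_%:R * _]mulrC mulrCA mulVf ?mulr1 // mulf_neq0 ?pnatr_eq0.
Qed.

(** The remainder [\int_0^1 (1 - t) p''(t) dt] taken coefficientwise: [beta_coef k] cancels the
    factor [(k+1)(k+2)] produced by two derivations. *)
Lemma taylor2_integral (p : {poly R}) (N : nat) : (size p <= N.+2)%N ->
  p.[1] - p.[0] - p^`().[0] = \sum_(k < N) beta_coef k * p^`()^`()`_k.
Proof.
move=> sp; rewrite (horner_coef_wide _ sp) !horner_coef0 coef_deriv mulr1n.
rewrite 2!big_ord_recl /= !expr1n !mulr1.
under [X in _ + (_ + X)]eq_bigr do rewrite expr1n mulr1.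
have -> : \sum_(k < N) beta_coef k * p^`()^`()`_k = \sum_(i < N) p`_i.+2.
  apply: eq_bigr => i _; rewrite !coef_deriv -mulrnA beta_coefK //.
by rewrite [X in X - _ - _]addrC addrK [X in X - _]addrC addrK.
Qed.

Lemma convex_horner (p : {poly R}) :
  (forall t, 0 <= t <= 1 -> 0 <= p^`()^`().[t]) -> p^`().[0] <= p.[1] - p.[0].
Proof.
move=> p2; have [c /itvP c01 ->] := poly_mvt p (ltr01 : 0 < 1 :> R).
rewrite subr0 mulr1 -subr_ge0.
have c0 : 0 < c by rewrite c01.
have [e /itvP e0c ->] := poly_mvt p^`() c0.
rewrite subr0 mulr_ge0 ?(ltW c0) // p2 // (ltW (_ : 0 < e)) ?e0c //=.
by rewrite (le_trans (ltW (_ : e < c))) ?e0c // ltW // c01.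
Qed.

Lemma beta_coef_sqr (N M : nat) (c : 'I_N -> R) : (N + N <= M)%N ->
  \sum_(k < M) beta_coef k * ((\sum_(a < N) c a *: 'X^a) ^+ 2)`_k =
  \sum_(a < N) \sum_(b < N) beta_coef (a + b) * (c a * c b).
Proof.
move=> NM; under eq_bigr => k _.
  rewrite expr2 mulr_suml coef_sum mulr_sumr.
  under eq_bigr => a _ do rewrite mulr_sumr coef_sum mulr_sumr.
  over.
rewrite exchange_big; apply: eq_bigr => a _; rewrite exchange_big.
apply: eq_bigr => b _ /=.
have abM : (a + b < M)%N by have := ltn_ord a; have := ltn_ord b; lia.
under eq_bigr => k _ do rewrite -scalerAl -scalerAr !coefZ -exprD coefXn.
rewrite (bigD1 (Ordinal abM)) //= big1 ?addr0 => [|k kab]; first by rewrite eqxx mulr1.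
by rewrite (_ : (k == (a + b)%N :> nat) = false) ?mulr0 //; apply/negbTE.
Qed.

(** The form is the integral of [(1 - t) q(t)^2] with [q = \sum_a c_a t^a], that is, the Taylor
    remainder at 0 of a convex polynomial whose second derivative is [q^2]. *)
Lemma beta_coef_psd (N : nat) (c : 'I_N -> R) :
  0 <= \sum_(a < N) \sum_(b < N) beta_coef (a + b) * (c a * c b).
Proof.
pose q := \sum_(a < N) c a *: 'X^a : {poly R}.
pose M := (size (q ^+ 2) + (N + N))%N.
(* The second antiderivative of [q ^+ 2] with zero value and zero slope at 0. *)
pose p : {poly R} := \poly_(i < M.+2) (if i is k.+2 then beta_coef k * (q ^+ 2)`_k else 0).
have p2 : p^`()^`() = q ^+ 2.
  apply/polyP => i; rewrite !coef_deriv coef_poly.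
  have [iM|Mi] := ltnP; last first.
    by rewrite nth_default ?mul0rn // (leq_trans _ (_ : (M <= i)%N)) // leq_addr.
  by rewrite -mulrnA -mulrnAr beta_coefK.
have := taylor2_integral (size_poly _ _ : (size p <= M.+2)%N).
rewrite p2 (beta_coef_sqr _ (leq_addl _ _)) => <-.
rewrite subr_ge0; apply: convex_horner => t _.
by rewrite p2 hornerE sqr_ge0.
Qed.

Lemma msize_le_coef (n k : nat) (p : mpoly n R) :
  (forall m, mcoeff m p != 0 -> (mdeg m <= k)%N) -> (msize p <= k.+1)%N.
Proof.
move=> h; rewrite msizeE; apply/bigmax_leqP_seq => m + _.
by rewrite mcoeff_msupp => /h.
Qed.

Lemma mdeg_le_msize (n k : nat) (p : mpoly n R) m :
  (msize p <= k.+1)%N -> mcoeff m p != 0 -> (mdeg m <= k)%N.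
Proof.
by move=> pk; rewrite -mcoeff_msupp -ltnS => /msize_mdeg_lt h; exact: leq_trans h pk.
Qed.

(* The leading monomials of the squares cannot cancel. *)
Lemma msize_sum_sqr (n q k : nat) (g : 'I_q -> mpoly n R) :
  (msize (\sum_(l < q) g l * g l) <= (2 * k).+1)%N ->
  forall l, (msize (g l) <= k.+1)%N.
Proof.
move=> hs l; have [->|gl0] := eqVneq (g l) 0; first by rewrite msize0.
have [l1 gl1 hl1] : exists2 l1, g l1 != 0 &
    forall j, g j != 0 -> (mlead (g j) <= mlead (g l1))%O.
  case: (@arg_maxP _ _ _ l (fun j => g j != 0) (fun j => mlead (g j)) gl0) => l1 h1 h2.
  by exists l1.
have le1 j : (mlead (g j) <= mlead (g l1))%O.
  by have [->|] := eqVneq (g j) 0; [rewrite mlead0 le0m|exact: hl1].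
have c2 : mcoeff (mnm_add (mlead (g l1)) (mlead (g l1))) (\sum_(l < q) g l * g l) != 0.
  rewrite raddf_sum /= psumr_neq0 => [|j _]; last by rewrite mleadcMW // -expr2 sqr_ge0.
  apply/hasP; exists l1; rewrite ?mem_index_enum //= mleadcMW // -expr2.
  by rewrite lt_neqAle sqr_ge0 andbT eq_sym sqrf_eq0 mleadc_eq0.
have := mdeg_le_msize hs c2; rewrite mdegD addnn -mul2n leq_pmul2l // => hk.
by rewrite -mlead_deg // ltnS (leq_trans _ hk) // lemc_mdeg.
Qed.

Lemma msize_mderiv (n k : nat) (p : mpoly n R) i :
  (msize p <= k.+1)%N -> (msize (mderiv i p) <= k.-1.+1)%N.
Proof.
move=> pk; apply: msize_le_coef => m; rewrite mcoeff_mderiv => h.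
have /(mdeg_le_msize pk) : mcoeff (mnm_add m (mnm1 i)) p != 0.
  by apply: contraNneq h => ->; rewrite mul0rn.
by rewrite mdegD mdeg1; lia.
Qed.

End Remainder.

(** * Sum-of-squares form of the Taylor remainder of an SOS-convex polynomial *)

Section SosTaylor.
Variable R : realType.

(** The outer variable is the line parameter [t]; the bound concerns the degree in [x] of its
    coefficients. *)
Definition coefs_deg_le (n k : nat) (Q : {poly mpoly n R}) : Prop :=
  forall a, (msize Q`_a <= k.+1)%N.

Lemma msize_sum_le (n k : nat) (I : Type) (r : seq I) (F : I -> mpoly n R) :
  (forall i, (msize (F i) <= k)%N) -> (msize (\sum_(i <- r) F i) <= k)%N.
Proof.
move=> h; apply: (big_ind (fun p : mpoly n R => (msize p <= k)%N)) => //.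
  by rewrite msize0.
by move=> p q hp hq; rewrite (leq_trans (msizeD_le _ _)) // geq_max hp hq.
Qed.

Lemma msizeM_leq (n k l : nat) (p q : mpoly n R) :
  (msize p <= k.+1)%N -> (msize q <= l.+1)%N -> (msize (p * q) <= (k + l).+1)%N.
Proof.
move=> hp hq; have [->|p0] := eqVneq p 0; first by rewrite mul0r msize0.
have [->|q0] := eqVneq q 0; first by rewrite mulr0 msize0.
by rewrite msizeM // -subn1 leq_subLR add1n -addnS -addSn leq_add.
Qed.

Lemma coefs_deg_leM (n k l : nat) (P Q : {poly mpoly n R}) :
  coefs_deg_le k P -> coefs_deg_le l Q -> coefs_deg_le (k + l) (P * Q).
Proof. by move=> hP hQ a; rewrite coefM; apply: msize_sum_le => i; exact: msizeM_leq. Qed.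

Lemma coefs_deg_le_sum (n k : nat) (I : Type) (r : seq I) (F : I -> {poly mpoly n R}) :
  (forall i, coefs_deg_le k (F i)) -> coefs_deg_le k (\sum_(i <- r) F i).
Proof. by move=> h a; rewrite coef_sum; apply: msize_sum_le => i; exact: h. Qed.

Lemma coefs_deg_le_polyC (n k : nat) (p : mpoly n R) :
  (msize p <= k.+1)%N -> coefs_deg_le k p%:P.
Proof. by move=> h a; rewrite coefC; case: eqP => // _; rewrite msize0. Qed.

Lemma msize_mpolyC_le (n : nat) (c : R) : (msize (mpolyC n c) <= 1)%N.
Proof. by rewrite msizeC; case: eqP. Qed.

Lemma msize_shiftX (n : nat) (i : 'I_n) (c : R) :
  (msize (mpolyX R (mnm1 i) - mpolyC n c) <= 2)%N.
Proof.
rewrite (leq_trans (msizeD_le _ _)) // msizeN msizeX mdeg1 geq_max leqnn /=.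
exact: leq_trans (msize_mpolyC_le _ _) _.
Qed.

Lemma line_polyM (n : nat) (u w : 'rV[R]_n) (f g : mpoly n R) :
  line_poly u w (f * g) = line_poly u w f * line_poly u w g.
Proof. exact: rmorphM. Qed.

Lemma line_poly_sum (n q : nat) (u w : 'rV[R]_n) (F : 'I_q -> mpoly n R) :
  line_poly u w (\sum_l F l) = \sum_l line_poly u w (F l).
Proof. exact: raddf_sum. Qed.

(* The polynomial [f (u + t (x - u))] in [t], whose coefficients are polynomials in [x]. *)
Definition gen_line_poly (n : nat) (u : 'rV[R]_n) (f : mpoly n R) : {poly mpoly n R} :=
  mmap (polyC \o @mpolyC n R)
    (fun i => (mpolyC n (u 0 i))%:P + (mpolyX R (mnm1 i) - mpolyC n (u 0 i)) *: 'X) f.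

Lemma map_gen_line_poly (n : nat) (u x : 'rV[R]_n) (f : mpoly n R) :
  map_poly (meval (fun i => x 0 i)) (gen_line_poly u f) = line_poly u (x - u) f.
Proof.
rewrite /gen_line_poly /line_poly; elim/mpoly_gen_ind: f => [c|i|p q hp hq|p q hp hq].
- by rewrite !mmapC /= map_polyC /= mevalC.
- rewrite !mmapX !mmap1U rmorphD /= map_polyC map_polyZ map_polyX /= mevalC.
  by rewrite mevalB mevalXU mevalC !mxE.
- by rewrite !mmapD -hp -hq; exact: rmorphD.
- by rewrite !(mmap_is_multiplicative _ _).1 -hp -hq; exact: rmorphM.
Qed.

(** Each variable is replaced by an expression of degree at most 1 in [x], so the degree in [x] does
    not grow. *)
Lemma coefs_deg_le_gen_line (n k : nat) (u : 'rV[R]_n) (f : mpoly n R) :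
  (msize f <= k.+1)%N -> coefs_deg_le k (gen_line_poly u f).
Proof.
move=> fk; rewrite /gen_line_poly /mmap big_seq; set h := (fun i : 'I_n => _ + _).
have hh i : coefs_deg_le 1 (h i).
  move=> a; rewrite coefD coefC coefZ coefX (leq_trans (msizeD_le _ _)) // geq_max.
  apply/andP; split; first by case: eqP => _; rewrite ?msize0 //
    (leq_trans (msize_mpolyC_le _ _)).
  by case: eqP => _; rewrite ?mulr1 ?mulr0 ?msize0 // msize_shiftX.
have h1 : coefs_deg_le 0 (1 : {poly mpoly n R}) by apply: coefs_deg_le_polyC; rewrite msize1.
have hm m : coefs_deg_le (mdeg m) (mmap1 h m).
  rewrite mdegE /mmap1; apply: (big_rec2 (fun k => coefs_deg_le k)) => // i l P _ hP.
  apply: coefs_deg_leM => //; elim: (m i) => [|e ih]; first by rewrite expr0.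
  by rewrite exprS -add1n; exact: coefs_deg_leM.
apply: (big_ind (coefs_deg_le k)) => [|P Q hP hQ|m mf].
- by move=> a; rewrite coef0 msize0.
- by move=> a; rewrite coefD (leq_trans (msizeD_le _ _)) // geq_max hP hQ.
- have mk : (mdeg m <= k)%N by apply: mdeg_le_msize fk _; rewrite -mcoeff_msupp.
  move=> a; rewrite /= mul_polyC coefZ mul_mpolyC (leq_trans (msizeZ_le _ _)) //.
  by rewrite (leq_trans (hm m a)).
Qed.

Definition mon_vec (n d : nat) (x : 'rV[R]_n) : 'cV[R]_(nmon n d) :=
  map_mx (fun p => evalp p x) (vmon R n d).

Definition coef_vec (n d : nat) (p : mpoly n R) : 'cV[R]_(nmon n d) :=
  \col_i mcoeff (bmnm (enum_val i)) p.

Definition quad (k : nat) (X : 'M[R]_k) (v : 'cV[R]_k) : R := (v^T *m X *m v) 0 0.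

(** Sums of squares of polynomials of degree at most [d], in Gram form. Stating this for functions
    lets it apply directly to Taylor remainders. *)
Definition gram_rep (n d : nat) (f : 'rV[R]_n -> R) : Prop :=
  exists2 X : 'M[R]_(nmon n d), psd X & forall x, f x = quad X (mon_vec d x).

Lemma evalp_coef_vec (n d : nat) (p : mpoly n R) x : (msize p <= d.+1)%N ->
  evalp p x = ((coef_vec d p)^T *m mon_vec d x) 0 0.
Proof.
move=> hp; rewrite {1}(mpolywE hp) /evalp raddf_sum mxE.
rewrite (reindex _ (onW_bij _ (@enum_val_bij (bmultinom n d.+1)))).
apply: eq_bigr => i _ /=; rewrite mevalZ !mxE //.
Qed.

Lemma quadD k (X Y : 'M[R]_k) v : quad (X + Y) v = quad X v + quad Y v.
Proof. by rewrite /quad mulmxDr mulmxDl mxE. Qed.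

Lemma quadZ k c (X : 'M[R]_k) v : quad (c *: X) v = c * quad X v.
Proof. by rewrite /quad -scalemxAr -scalemxAl mxE. Qed.

Lemma quad0 k (v : 'cV[R]_k) : quad 0 v = 0.
Proof. by rewrite /quad mulmx0 mul0mx mxE. Qed.

Lemma quad_sum k (I : Type) (r : seq I) (P : pred I) (X : I -> 'M[R]_k) v :
  quad (\sum_(i <- r | P i) X i) v = \sum_(i <- r | P i) quad (X i) v.
Proof.
by apply: (big_morph (fun X => quad X v)) => [Y Z|]; [exact: quadD|exact: quad0].
Qed.

Lemma quad_rank1 k (w1 w2 v : 'cV[R]_k) :
  quad (w1 *m w2^T) v = (w1^T *m v) 0 0 * (w2^T *m v) 0 0.
Proof.
rewrite /quad !mulmxA -mulmxA mxE big_ord1; congr (_ * _).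
by rewrite -[w1 in LHS]trmxK -trmx_mul mxE.
Qed.

Theorem sos_taylor (n d : nat) (f : mpoly n R) (u : 'rV[R]_n) :
  deg_le (2 * d) f -> sos_convex f ->
  gram_rep d (fun x => evalp f x - evalp f u
                       - \sum_i (x - u) 0 i * evalp (mderiv i f) u).
Proof.
move=> fd [q [F hF]].
case: d => [|d] in fd *.
  exists 0 => [|x].
    by split; [rewrite trmx0|move=> v; rewrite mulmx0 mul0mx mxE].
  rewrite (msize1_polyC fd) /evalp !mevalC quad0 subrr sub0r big1 ?oppr0 // => i _.
  by rewrite mderivC meval0 mulr0.
have hFi i j : \sum_(l < q) F i l * F j l = mderiv j (mderiv i f).
  by have /matrixP/(_ i j) := hF; rewrite !mxE => ->; apply: eq_bigr => l _; rewrite mxE.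
(* Diagonal Hessian entries are sums of squares of degree at most [2 * d] after the shift of [d], so
   every entry of [F] has degree at most [d]. *)
have Fd i l : (msize (F i l) <= d.+1)%N.
  move: l; apply: msize_sum_sqr; rewrite hFi.
  have -> : (2 * d)%N = (2 * d.+1).-1.-1 by lia.
  by do 2!apply: msize_mderiv.
(* The direction [x - u] contracted with column [l] of [F] along the segment; the extra factor
   raises the degree in [x] to [d.+1]. *)
pose Q l := \sum_i (mpolyX R (mnm1 i) - mpolyC n (u 0 i))%:P * gen_line_poly u (F i l).
have Qd l : coefs_deg_le d.+1 (Q l).
  apply: coefs_deg_le_sum => i; rewrite -add1n; apply: coefs_deg_leM.
    by apply: coefs_deg_le_polyC; exact: msize_shiftX.
  exact: coefs_deg_le_gen_line.
pose N := (\sum_l size (Q l))%N.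
pose w l a := coef_vec d.+1 (Q l)`_a.
(* Integrating [(1 - t) Q_l(t)^2] gives the beta kernel applied to the coefficient vectors of the
   powers of [t] in [Q l]. *)
pose X := \sum_l \sum_(a < N) \sum_(b < N) beta_coef R (a + b) *: (w l a *m (w l b)^T).
have quadX v : quad X v = \sum_l \sum_(a < N) \sum_(b < N)
    beta_coef R (a + b) * (((w l a)^T *m v) 0 0 * ((w l b)^T *m v) 0 0).
  rewrite quad_sum; apply: eq_bigr => l _; rewrite quad_sum; apply: eq_bigr => a _.
  by rewrite quad_sum; apply: eq_bigr => b _; rewrite quadZ quad_rank1.
exists X.
  split=> [|v]; last by rewrite -/(quad X v) quadX sumr_ge0 // => l _; exact: beta_coef_psd.
  rewrite /X raddf_sum; apply: eq_bigr => l _; rewrite raddf_sum /=.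
  under eq_bigr => a _ do rewrite raddf_sum /=.
  rewrite exchange_big; apply: eq_bigr => a _; apply: eq_bigr => b _ /=.
  by rewrite linearZ /= trmx_mul trmxK addnC.
move=> x; rewrite quadX.
pose phi := line_poly u (x - u) f.
pose ql l := map_poly (meval (fun i => x 0 i)) (Q l).
have qlE l : ql l = \sum_i (x - u) 0 i *: line_poly u (x - u) (F i l).
  rewrite /ql /Q raddf_sum; apply: eq_bigr => i _ /=.
  by rewrite rmorphM /= map_polyC /= mevalB mevalXU mevalC mul_polyC map_gen_line_poly !mxE.
(* The second derivative along the segment is the Hessian form in the direction [x - u], and
   [F *m F^T] splits it into squares. *)
have phi2 : phi^`()^`() = \sum_l ql l ^+ 2.
  rewrite /phi deriv_line_poly raddf_sum /=.
  under eq_bigr => i _.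
    rewrite derivZ deriv_line_poly scaler_sumr.
    under eq_bigr => j _ do rewrite -hFi line_poly_sum !scaler_sumr.
    rewrite exchange_big.
    over.
  rewrite exchange_big; apply: eq_bigr => l _ /=.
  rewrite expr2 {1}qlE mulr_suml; apply: eq_bigr => i _.
  rewrite qlE mulr_sumr; apply: eq_bigr => j _.
  by rewrite line_polyM -scalerAl -scalerAr scalerA.
have phi' : phi^`().[0] = \sum_i (x - u) 0 i * evalp (mderiv i f) u.
  rewrite /phi deriv_line_poly horner_sum; apply: eq_bigr => i _.
  by rewrite hornerZ horner_line_poly scale0r addr0.
have -> : evalp f x - evalp f u = phi.[1] - phi.[0].
  by rewrite !horner_line_poly scale1r scale0r addr0 [u + _]addrC subrK.
rewrite -phi' (@taylor2_integral _ _ (size phi + (N + N))%N); last first.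
  by rewrite (leq_trans (leq_addr (N + N) _)) // -addn2 leq_addr.
rewrite phi2; under eq_bigr do rewrite coef_sum mulr_sumr.
rewrite exchange_big; apply: eq_bigr => l _ /=.
have -> : ql l = \sum_(a < N) ((w l a)^T *m mon_vec d.+1 x) 0 0 *: 'X^a.
  have sq : (size (ql l) <= N)%N.
    by rewrite (leq_trans (size_poly _ _)) // /N (bigD1 l) //= leq_addr.
  have -> : ql l = \poly_(a < N) (ql l)`_a.
    apply/polyP => a; rewrite coef_poly; case: ltnP => // Na.
    by rewrite nth_default // (leq_trans sq Na).
  rewrite poly_def; apply: eq_bigr => a _; congr (_ *: _).
  by rewrite coef_map /= -evalp_coef_vec //; exact: Qd.
by rewrite beta_coef_sqr // leq_addl.
Qed.

End SosTaylor.

(** * Minima of continuous functions *)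

Section Minima.
Variable R : realType.

Section ContinuousRealFunctions.
Variable T : topologicalType.
Implicit Types f g : T -> R.

Lemma continuous_addr f g :
  continuous f -> continuous g -> continuous (fun x => f x + g x).
Proof. by move=> cf cg x; apply: continuousD; [exact: cf|exact: cg]. Qed.

Lemma continuous_mulr f g :
  continuous f -> continuous g -> continuous (fun x => f x * g x).
Proof. by move=> cf cg x; apply: continuousM; [exact: cf|exact: cg]. Qed.

Lemma continuous_cstr (c : R) : continuous (fun _ : T => c).
Proof. by move=> x; exact: cst_continuous. Qed.

Lemma continuous_sumr (I : Type) (r : seq I) (F : I -> T -> R) :
  (forall i, continuous (F i)) -> continuous (fun x => \sum_(i <- r) F i x).
Proof.
move=> cF; elim: r => [|i r ih].
  rewrite (_ : (fun x => _) = fun=> 0) => [|//]; first exact: continuous_cstr.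
  by apply/funext => x; rewrite big_nil.
rewrite (_ : (fun x => _) = fun x => F i x + \sum_(j <- r) F j x) => [|//].
  exact: continuous_addr.
by apply/funext => x; rewrite big_cons.
Qed.

Lemma closed_le_fun f g :
  continuous f -> continuous g -> closed [set x | f x <= g x].
Proof.
move=> cf cg.
rewrite (_ : mkset _ = (fun x => g x + -1 * f x) @^-1` [set t | 0 <= t]).
  apply: closed_comp; last exact: closed_ge.
  move=> x _; apply: continuous_addr cg _ x.
  by apply: continuous_mulr cf; exact: continuous_cstr.
by apply/seteqP; split => x /=; rewrite mulN1r subr_ge0.
Qed.

Lemma closed_forall (I : Type) (P : I -> set T) :
  (forall i, closed (P i)) -> closed [set x | forall i, P i x].
Proof.
move=> cP; rewrite (_ : mkset _ = \bigcap_(i in setT) P i); first exact: closed_bigI.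
by apply/seteqP; split => [x h i _|x h i]; exact: h.
Qed.

(** Weierstrass under coercivity: compactness is asked only of a set [B] that contains the part of
    [S] where [f] is at most [f x0]. *)
Lemma closed_sublevel_min f (S B : set T) x0 :
  closed S -> compact B -> continuous f -> S x0 ->
  (forall x, S x -> f x <= f x0 -> B x) ->
  exists2 c, S c & forall x, S x -> f c <= f x.
Proof.
move=> cS cB cf Sx0 SB; pose A := B `&` (S `&` [set x | f x <= f x0]).
have cA : compact A.
  apply: compact_closedI => //; apply: closedI => //; apply: closed_le_fun => //.
  exact: continuous_cstr.
have Ax0 : A x0 by split; [exact: SB|split => //=].
have [|c] := @compact_EVT_min _ _ f A (ex_intro _ _ Ax0) cA.
  exact: continuous_subspaceT.
rewrite inE => -[_ [Sc /= cx0]] hmin; exists c => // x Sx.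
have [xx0|/ltW x0x] := leP (f x) (f x0); last exact: le_trans x0x.
by apply: hmin; rewrite inE; split; [exact: SB|split].
Qed.

End ContinuousRealFunctions.

Lemma continuous_coord (n : nat) (i : 'I_n) : continuous (fun v : 'rV[R]_n => v 0 i).
Proof. exact: coord_continuous. Qed.

Lemma continuous_evalp (n : nat) (p : mpoly n R) : continuous (evalp p).
Proof.
elim/mpoly_gen_ind: p => [c|i|p q hp hq|p q hp hq].
- rewrite (_ : evalp _ = fun=> c); first exact: continuous_cstr.
  by apply/funext => x; rewrite /evalp mevalC.
- rewrite (_ : evalp _ = fun x => x 0 i); first exact: continuous_coord.
  by apply/funext => x; rewrite /evalp mevalXU.
- rewrite (_ : evalp _ = fun x => evalp p x + evalp q x); first exact: continuous_addr.
  by apply/funext => x; rewrite /evalp mevalD.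
- rewrite (_ : evalp _ = fun x => evalp p x * evalp q x); first exact: continuous_mulr.
  by apply/funext => x; rewrite /evalp mevalM.
Qed.

Lemma compact_box (n : nat) (M : R) :
  compact [set v : 'rV[R]_n | forall i, `|v 0 i| <= M].
Proof.
rewrite (_ : mkset _ = [set v : 'rV[R]_n | forall i, `[- M, M]%classic (v ord0 i)]).
  by apply: (@rV_compact R n (fun=> `[- M, M]%classic)) => _; exact: segment_compact.
by apply/seteqP; split => v /= h i; have := h i; rewrite /= in_itv /= ler_norml.
Qed.

(** Fermat's rule for the restriction to each coordinate line through [u]. *)
Lemma evalp_min_grad (n : nat) (p : mpoly n R) u :
  (forall x, evalp p u <= evalp p x) -> forall i, evalp (mderiv i p) u = 0.
Proof.
move=> hu i; pose q := line_poly u (delta_mx 0 i) p.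
have q' : q^`().[0] = evalp (mderiv i p) u.
  rewrite /q deriv_line_poly (bigD1 i) //= big1 => [|j /negPf ji].
    by rewrite addr0 mxE !eqxx scale1r horner_line_poly scale0r addr0.
  by rewrite mxE ji andbF scale0r.
have d0 : is_derive (0 : R) 1 (horner q) 0.
  apply: (@derive1_at_min _ _ (-1) 1) => [|t _||t _].
  - by rewrite (le_trans (lerN10 _)).
  - exact: derivable_horner.
  - by rewrite in_itv /= ltrN10 ltr01.
  - by rewrite !horner_line_poly scale0r addr0.
by rewrite -q'; have [_ <-] := is_derive_poly q 0; case: d0.
Qed.

End Minima.

(** * The cone of Gram-representable polynomials *)

Section GramCone.
Variable R : realType.

Lemma psd0 k : psd (0 : 'M[R]_k).
Proof. by split; [rewrite trmx0|move=> v; rewrite mulmx0 mul0mx mxE]. Qed.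

Lemma psdD k (X Y : 'M[R]_k) : psd X -> psd Y -> psd (X + Y).
Proof.
move=> [sX pX] [sY pY]; split; first by rewrite linearD /= sX sY.
by move=> v; rewrite -/(quad _ v) quadD addr_ge0 ?pX ?pY.
Qed.

Lemma psdZ k c (X : 'M[R]_k) : 0 <= c -> psd X -> psd (c *: X).
Proof.
move=> c0 [sX pX]; split; first by rewrite linearZ /= sX.
by move=> v; rewrite -/(quad _ v) quadZ mulr_ge0 ?pX.
Qed.

Lemma gram_repD (n d : nat) (f g : 'rV[R]_n -> R) :
  gram_rep d f -> gram_rep d g -> gram_rep d (fun x => f x + g x).
Proof.
move=> [X pX hX] [Y pY hY]; exists (X + Y); first exact: psdD.
by move=> x; rewrite quadD hX hY.
Qed.

Lemma gram_repZ (n d : nat) c (f : 'rV[R]_n -> R) :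
  0 <= c -> gram_rep d f -> gram_rep d (fun x => c * f x).
Proof.
by move=> c0 [X pX hX]; exists (c *: X) => [|x]; [exact: psdZ|rewrite quadZ hX].
Qed.

Lemma gram_rep_sum (n d : nat) (I : Type) (r : seq I) (f : I -> 'rV[R]_n -> R) :
  (forall i, gram_rep d (f i)) -> gram_rep d (fun x => \sum_(i <- r) f i x).
Proof.
move=> hf; elim: r => [|i r [X pX hX]].
  by exists 0 => [|x]; [exact: psd0|rewrite big_nil quad0].
have [Y pY hY] := hf i; exists (Y + X); first exact: psdD.
by move=> x; rewrite big_cons quadD hX hY.
Qed.

Lemma gram_rep_sqr (n d : nat) (p : mpoly n R) :
  (msize p <= d.+1)%N -> gram_rep d (fun x => evalp p x ^+ 2).
Proof.
move=> hp; exists (coef_vec d p *m (coef_vec d p)^T).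
  split=> [|v]; first by rewrite trmx_mul trmxK.
  by rewrite -/(quad _ v) quad_rank1 -expr2 sqr_ge0.
by move=> x; rewrite quad_rank1 -evalp_coef_vec.
Qed.

Lemma gram_rep_ge0 (n d : nat) (f : 'rV[R]_n -> R) x : gram_rep d f -> 0 <= f x.
Proof. by move=> [X [_ pX] ->]; exact: pX. Qed.

Lemma eq_gram_rep (n d : nat) (f g : 'rV[R]_n -> R) :
  f =1 g -> gram_rep d f -> gram_rep d g.
Proof. by move=> fg [X pX hX]; exists X => // x; rewrite -fg. Qed.

(** The index order [X j i] makes the coefficients equal to the traces in the dual constraints, with
    no symmetry assumption on [X]. *)
Definition gram_poly (n d : nat) (X : 'M[R]_(nmon n d)) : mpoly n R :=
  \sum_i \sum_j X j i *: (vmon R n d *m (vmon R n d)^T) i j.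

Lemma evalp_gram_poly (n d : nat) (X : 'M[R]_(nmon n d)) x : X^T = X ->
  evalp (gram_poly X) x = quad X (mon_vec d x).
Proof.
move=> sX; rewrite /gram_poly /evalp raddf_sum /quad mxE.
under eq_bigr => i _ do rewrite raddf_sum /=.
rewrite exchange_big /=; apply: eq_bigr => j _.
rewrite mxE mulr_suml; apply: eq_bigr => i _ /=.
have -> : X i j = X j i by rewrite -[in LHS]sX mxE.
rewrite mevalZ !mxE big_ord1 mevalM !mxE /evalp.
by rewrite mulrCA mulrA.
Qed.

Lemma mcoeff_gram_poly (n d : nat) (X : 'M[R]_(nmon n d)) a :
  mcoeff a (gram_poly X) = \tr (Bmat R d a *m X).
Proof.
rewrite /gram_poly raddf_sum; apply: eq_bigr => i _; rewrite raddf_sum mxE.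
apply: eq_bigr => j _; rewrite /= mcoeffZ mulrC; congr (_ * _).
by rewrite [RHS]mxE.
Qed.

Lemma gram_repP (n d : nat) (p : mpoly n R) : gram_rep d (evalp p) ->
  exists2 X : 'M[R]_(nmon n d), psd X & forall a, mcoeff a p = \tr (Bmat R d a *m X).
Proof.
move=> [X pX hX]; exists X => // a; rewrite -mcoeff_gram_poly; congr mcoeff.
by apply: evalp_inj => x; rewrite evalp_gram_poly ?hX //; case: pX.
Qed.

(** The dual constrains only exponents of degree at most [2 * d]; above that degree both the
    coefficient and the trace vanish. *)
Lemma gram_repI (n d : nat) (p : mpoly n R) (X : 'M[R]_(nmon n d)) :
  psd X -> deg_le (2 * d) p ->
  (forall a, (mdeg a <= 2 * d)%N -> mcoeff a p = \tr (Bmat R d a *m X)) ->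
  gram_rep d (evalp p).
Proof.
move=> pX hp hX; exists X => // x; rewrite -evalp_gram_poly; last by case: pX.
congr (evalp _ x); apply/mpolyP => a; rewrite mcoeff_gram_poly.
have [|ha] := leqP (mdeg a) (2 * d); first exact: hX.
transitivity (0 : R).
  by apply/eqP; apply: contraTT ha => /(mdeg_le_msize hp); rewrite -leqNgt.
rewrite /mxtrace big1 // => i _; rewrite mxE big1 // => j _.
rewrite !mxE big_ord1 !mxE -mpolyXD mcoeffX.
case: eqP => [e|_]; last by rewrite mul0r.
move: ha; rewrite -e mdegD ltnNge mul2n -addnn leq_add // -ltnS; exact: bmdeg.
Qed.

Lemma quad_scale_add k (X : 'M[R]_k) (t : R) (v w : 'cV[R]_k) :
  quad X (t *: v + w) = t * (t * quad X v + (v^T *m X *m w) 0 0) +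
                        (t * (w^T *m X *m v) 0 0 + quad X w).
Proof.
rewrite /quad; have -> : (t *: v + w)^T = t *: v^T + w^T by apply/matrixP => i j; rewrite !mxE.
rewrite !(mulmxDl, mulmxDr) -!scalemxAl -!scalemxAr.
move: (_ *m v) (_ *m w) (w^T *m X *m v) (w^T *m X *m w) => A B C E.
by rewrite !mxE; ring.
Qed.

Lemma quad_delta2 k (X : 'M[R]_k) i j t :
  quad X (t *: delta_mx i 0 + delta_mx j 0) =
  t * (t * X i i + X i j) + (t * X j i + X j j).
Proof.
have e a b : ((delta_mx a 0 : 'cV[R]_k)^T *m X *m (delta_mx b 0 : 'cV[R]_k)) 0 0 = X a b.
  by rewrite trmx_delta -rowE -colE !mxE.
rewrite quad_scale_add -!/(quad _ _) /quad !e; ring.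
Qed.

(** With a zero diagonal entry the form is affine in [t] along [t e_i + e_j], with slope [2 X_ij],
    so nonnegativity forces the slope to vanish. *)
Lemma psd_diag0 k (X : 'M[R]_k) i j : psd X -> X i i = 0 -> X i j = 0.
Proof.
move=> [sX pX] Xii; have Xji : X j i = X i j by rewrite -[in LHS]sX mxE.
apply/eqP; apply: contraT => Xij.
(* At this [t] the form takes the value -1. *)
have := pX (- (X j j + 1) / (2 * X i j) *: delta_mx i 0 + delta_mx j 0).
rewrite -/(quad _ _) quad_delta2 Xji Xii mulr0 add0r.
set t := _ / _; have -> : t * X i j = - (X j j + 1) / 2 by rewrite /t; field.
by move: (X j j) => a; lra.
Qed.

(* Among the nonzero diagonal entries take the one whose monomial [m] is the largest: the
   coefficient of [m + m] in the Gram polynomial is that entry alone. *)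
Lemma gram_definite (n d : nat) (X : 'M[R]_(nmon n d)) : psd X ->
  (forall a, (mdeg a <= 2 * d)%N -> \tr (Bmat R d a *m X) = 0) -> X = 0.
Proof.
move=> pX hX; have [sX _] := pX; pose mon (i : 'I_(nmon n d)) := bmnm (enum_val i).
have [/forallP h0|] := boolP [forall i, X i i == 0].
  by apply/matrixP => i j; rewrite (psd_diag0 _ pX) ?mxE //; exact/eqP.
move=> /forallPn[i0 Xi0].
have [i Xi hi] : exists2 i, X i i != 0 & forall j, X j j != 0 -> (mon j <= mon i)%O.
  case: (@arg_maxP _ _ _ i0 (fun j => X j j != 0) mon Xi0) => l1 h1 h2.
  by exists l1.
have inj_mon : injective mon by move=> a b /val_inj /enum_val_inj.
case/eqP: Xi; rewrite -(hX (mnm_add (mon i) (mon i))); last first.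
  by rewrite mdegD addnn -mul2n leq_mul2l -ltnS bmdeg.
rewrite /mxtrace (bigD1 i) //= mxE (bigD1 i) //= !mxE big_ord1 !mxE -mpolyXD mcoeffX eqxx mul1r.
(* A nonzero [X b a] forces both diagonal entries to be nonzero, so both monomials are at most
   [mon i], and their product is its square only if both equal it. *)
have z a b : ~~ ((a == i) && (b == i)) ->
    Bmat R d (mnm_add (mon i) (mon i)) a b * X b a = 0.
  move=> abi; have [->|Xba] := eqVneq (X b a) 0; first by rewrite mulr0.
  have Xb : X b b != 0 by apply: contraNneq Xba => /(psd_diag0 _ pX) ->.
  have Xa : X a a != 0 by apply: contraNneq Xba => Xaa; rewrite -sX mxE (psd_diag0 b pX Xaa).
  rewrite !mxE big_ord1 !mxE -mpolyXD mcoeffX -/(mon a) -/(mon b).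
  case: eqP => [e|_]; last by rewrite mul0r.
  case/negP: abi; rewrite -!(inj_eq inj_mon).
  have [la lb] := (hi a Xa, hi b Xb).
  have ea : mon a = mon i.
    apply/eqP; rewrite eq_le la leNgt; apply/negP => lt.
    by have := ltmc_le_add lt lb; rewrite e ltxx.
  by rewrite ea eqxx /=; move: e; rewrite ea => /addmI ->.
rewrite big1 => [|j /negPf ji]; last by rewrite z // ji andbF.
rewrite big1 ?addr0 // => j /negPf ji; rewrite mxE big1 // => l _.
by rewrite z // ji.
Qed.

Lemma dotp_ge0 k (w : 'rV[R]_k) : 0 <= dotp w w.
Proof. by rewrite sumr_ge0 // => i _; rewrite -expr2 sqr_ge0. Qed.

Lemma dotp_coord_le k (w : 'rV[R]_k) i : w 0 i ^+ 2 <= dotp w w.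
Proof.
rewrite /dotp (bigD1 i) //= -expr2 lerDl sumr_ge0 // => j _.
by rewrite -expr2 sqr_ge0.
Qed.

Lemma continuous_dotp k : continuous (fun w : 'rV[R]_k => dotp w w).
Proof.
apply: continuous_sumr => i.
by apply: continuous_mulr; exact: continuous_coord.
Qed.

(** * Closedness of the Gram cone *)

Section ClosedGramCone.
Variables n d : nat.
Let N := nmon n d.
Implicit Types w : 'rV[R]_(N * N).

(** Matrices are flattened into row vectors, where boxes are known to be compact and [dotp] is the
    squared Frobenius norm. *)
Let trB w (a : bmultinom n (2 * d).+1) : R := \tr (Bmat R d (bmnm a) *m vec_mx w).

Let continuous_entry i j : continuous (fun w => (vec_mx w : 'M[R]_N) i j).
Proof.
rewrite (_ : (fun w => _) = fun w => w 0 (mxvec_index i j)); first exact: continuous_coord.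
by apply/funext => w; rewrite mxE.
Qed.

Let continuous_quad v : continuous (fun w => quad (vec_mx w : 'M[R]_N) v).
Proof.
rewrite (_ : (fun w => _) = fun w =>
  \sum_j (\sum_i v i 0 * (vec_mx w : 'M[R]_N) i j) * v j 0).
  apply: continuous_sumr => j; apply: continuous_mulr; last exact: continuous_cstr.
  apply: continuous_sumr => i; apply: continuous_mulr; first exact: continuous_cstr.
  exact: continuous_entry.
apply/funext => w; rewrite /quad mxE; apply: eq_bigr => j _; rewrite mxE.
by congr (_ * _); apply: eq_bigr => i _; rewrite mxE.
Qed.

Let continuous_trB a : continuous (trB ^~ a).
Proof.
rewrite (_ : trB ^~ a = fun w =>
  \sum_i \sum_j Bmat R d (bmnm a) i j * (vec_mx w : 'M[R]_N) j i).
  apply: continuous_sumr => i; apply: continuous_sumr => j.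
  by apply: continuous_mulr; [exact: continuous_cstr|exact: continuous_entry].
by apply/funext => w; apply: eq_bigr => i _; rewrite mxE.
Qed.

Let closed_psd : closed [set w | psd (vec_mx w : 'M[R]_N)].
Proof.
(* Symmetry is written as inequalities between transposed entries, so that closedness follows from
   [closed_le_fun]. *)
rewrite (_ : mkset _ =
  [set w | forall i j, (vec_mx w : 'M[R]_N) i j <= (vec_mx w : 'M[R]_N) j i] `&`
  [set w | forall v, 0 <= quad (vec_mx w : 'M[R]_N) v]).
  apply: closedI; last first.
    by apply: closed_forall => v; apply: closed_le_fun => //; exact: continuous_cstr.
  by apply: closed_forall => i; apply: closed_forall => j; exact: closed_le_fun.
apply/seteqP; split => w /= [h1 h2]; split => //.
  by move=> i j; rewrite -[in leLHS]h1 mxE.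
by apply/matrixP => i j; rewrite mxE; apply/eqP; rewrite eq_le !h1.
Qed.

(** On psd matrices of norm 1 the sum of squared traces is positive by [gram_definite]; its minimum
    there is [kappa], and homogeneity extends the bound. *)
Let gram_coercive : exists2 kappa : R, 0 < kappa &
  forall w, psd (vec_mx w : 'M[R]_N) -> kappa * dotp w w <= \sum_a trB w a ^+ 2.
Proof.
pose S := [set w | psd (vec_mx w : 'M[R]_N)] `&` [set w | dotp w w = 1].
have cS : closed S.
  apply: closedI => //; rewrite (_ : mkset _ =
    [set w | dotp w w <= 1] `&` [set w | 1 <= dotp w w]).
    by apply: closedI; apply: closed_le_fun; (exact: continuous_dotp || exact: continuous_cstr).
  apply/seteqP; split => [w /= ->|w /= [h1 h2]]; first by rewrite lexx.
  by apply/eqP; rewrite eq_le h1 h2.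
have scale w : psd (vec_mx w : 'M[R]_N) -> 0 < dotp w w ->
    S ((Num.sqrt (dotp w w))^-1 *: w).
  move=> pw w0; split => /=.
    by rewrite linearZ; apply: psdZ => //; rewrite invr_ge0 sqrtr_ge0.
  have -> : dotp ((Num.sqrt (dotp w w))^-1 *: w) ((Num.sqrt (dotp w w))^-1 *: w) =
      (Num.sqrt (dotp w w)) ^- 2 * dotp w w.
    rewrite {1}/dotp [in RHS]/dotp mulr_sumr; apply: eq_bigr => i _.
    by rewrite !mxE -exprVn expr2; ring.
  by rewrite sqr_sqrtr ?ltW // mulVf // gt_eqF.
(* If the unit slice is empty, every psd matrix has norm zero and any [kappa] works. *)
have [[w0 Sw0]|S0] := pselect (exists w, S w); last first.
  exists 1 => // w pw; have [w0|w0] := ltP 0 (dotp w w).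
    by case: S0; eexists; exact: scale pw w0.
  by rewrite (le_trans (_ : _ <= 0)) ?mul1r // sumr_ge0 // => a _; exact: sqr_ge0.
have cPsi : continuous (fun w => \sum_a trB w a ^+ 2).
  by apply: continuous_sumr => a; apply: continuous_mulr.
have [|c [pc c1] hc] := @closed_sublevel_min _ _ _ S _ w0 cS (@compact_box R (N * N) 1) cPsi Sw0.
  move=> w [_ /= w1] _ i; rewrite -(ler_pXn2r (_ : 0 < 2)%N) ?nnegrE //.
  by rewrite real_normK ?num_real // expr1n -w1; exact: dotp_coord_le.
exists (\sum_a trB c a ^+ 2) => [|w pw]; last first.
  have [w1|w1] := ltP 0 (dotp w w); last first.
    have -> : dotp w w = 0 by apply/eqP; rewrite eq_le w1 dotp_ge0.
    by rewrite mulr0 sumr_ge0 // => a _; exact: sqr_ge0.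
  rewrite -ler_pdivlMr // (le_trans (hc _ (scale w pw w1))) // mulr_suml.
  apply: ler_sum => a _; rewrite /trB linearZ -scalemxAr mxtraceZ exprMn exprVn.
  by rewrite (sqr_sqrtr (ltW w1)) [leLHS]mulrC.
rewrite lt_neqAle sumr_ge0 ?andbT => [|a _]; last exact: sqr_ge0.
apply: contra_eqN c1 => /eqP/esym h0.
have c0 : (vec_mx c : 'M[R]_N) = 0.
  apply: gram_definite pc _ => a ha.
  have := psumr_eq0P (fun b _ => sqr_ge0 (trB c b)) h0.
  move/(_ (BMultinom (ha : (mdeg a < (2 * d).+1)%N)) isT) => /eqP.
  by rewrite sqrf_eq0 => /eqP.
rewrite -[c]vec_mxK c0 linear0 /dotp big1 ?(eq_sym 0) ?oner_eq0 // => i _.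
by rewrite mxE mul0r.
Qed.

(** A least squares argument: [f] measures the distance from the Gram coefficients to those of [p].
    It attains its minimum by coercivity, and it takes the values [e ^+ 2 * C] for all [e > 0], so
    the minimum is 0. *)
Lemma gram_rep_closed (p r : mpoly n R) : deg_le (2 * d) p ->
  (forall e, 0 < e -> gram_rep d (evalp (p + e *: r))) -> gram_rep d (evalp p).
Proof.
move=> hp hr; have [kappa k0 hk] := gram_coercive.
pose S := [set w | psd (vec_mx w : 'M[R]_N)].
pose f w := \sum_a (trB w a + - mcoeff (bmnm a) p) ^+ 2.
have cf : continuous f.
  apply: continuous_sumr => a; apply: continuous_mulr.
    by apply: continuous_addr => //; exact: continuous_cstr.
  by apply: continuous_addr => //; exact: continuous_cstr.
pose C := \sum_(a : bmultinom n (2 * d).+1) mcoeff (bmnm a) r ^+ 2.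
have small e : 0 < e -> exists2 w, S w & f w = e ^+ 2 * C.
  move=> e0; have [X pX hX] := gram_repP (hr e e0).
  exists (mxvec X); first by rewrite /S /= mxvecK.
  rewrite /f /C mulr_sumr; apply: eq_bigr => a _.
  by rewrite /trB mxvecK -hX mcoeffD mcoeffZ addrAC subrr add0r exprMn.
have [w1 Sw1 _] := small 1 ltr01.
(* From [x^2 <= 2 ((x - y)^2 + y^2)] and coercivity, the sublevel set satisfies
   [|w|^2 <= M - 1 <= M^2]. *)
pose M := 2 * (f w1 + \sum_(a : bmultinom n (2 * d).+1) mcoeff (bmnm a) p ^+ 2) / kappa + 1.
have M1 : 1 <= M.
  rewrite /M lerDr divr_ge0 ?(ltW k0) // mulr_ge0 // addr_ge0 // sumr_ge0 // => a _;
  exact: sqr_ge0.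
have M0 : 0 <= M := le_trans ler01 M1.
have [|c Sc hc] := @closed_sublevel_min _ _ f S _ w1 closed_psd
    (@compact_box R (N * N) M) cf Sw1.
  move=> w Sw fw i; rewrite -(ler_pXn2r (_ : 0 < 2)%N) ?nnegrE //.
  rewrite real_normK ?num_real // (le_trans (dotp_coord_le _ _)) //.
  have hM : dotp w w <= M - 1.
    rewrite /M addrK ler_pdivlMr // mulrC (le_trans (hk _ Sw)) //.
    rewrite (le_trans (_ : _ <= 2 * (f w + \sum_(a : bmultinom n (2 * d).+1) mcoeff (bmnm a) p ^+ 2))) //.
      rewrite /f -big_split mulr_sumr; apply: ler_sum => a _ /=.
      by move: (trB w a) (mcoeff _ p) => x y; have := sqr_ge0 (x - 2 * y); nra.
    by rewrite ler_pM2l // lerD2r.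
  by rewrite (le_trans hM) // expr2; nra.
have fc0 : f c = 0.
  have f0 w : 0 <= f w by rewrite sumr_ge0 // => a _; exact: sqr_ge0.
  have C0 : 0 <= C by rewrite sumr_ge0 // => a _; exact: sqr_ge0.
  apply/eqP; rewrite eq_le f0 andbT leNgt; apply/negP => fc.
  (* This [e] is below 1, hence [e^2 C <= e C < f c], against minimality. *)
  pose e := f c / (C + f c + 1).
  have D0 : 0 < C + f c + 1 by lra.
  have e0 : 0 < e by rewrite divr_gt0.
  have [w Sw fw] := small e e0; have := hc w Sw; rewrite fw leNgt => /negP; apply.
  have e1 : e < 1 by rewrite ltr_pdivrMr // mul1r; lra.
  have eE : e * (C + f c + 1) = f c by rewrite mulfVK // gt_eqF.
  nra.
apply: (gram_repI (X := vec_mx c)) => // a ha.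
have := psumr_eq0P (fun b _ => sqr_ge0 (trB c b + - mcoeff (bmnm b) p)) fc0.
move/(_ (BMultinom (ha : (mdeg a < (2 * d).+1)%N)) isT) => /eqP.
by rewrite sqrf_eq0 subr_eq0 => /eqP <-.
Qed.

End ClosedGramCone.

End GramCone.

(** * Nonnegative SOS-convex polynomials are sums of squares *)

Section SosNonneg.
Variable R : realType.

(** The consequence of SOS-convexity used from here on. It passes to sums and nonnegative multiples
    by adding Gram matrices, without building a new Hessian factor. *)
Definition sos_taylor_rem (n d : nat) (f : mpoly n R) : Prop :=
  forall u : 'rV[R]_n, gram_rep d (fun x => evalp f x - evalp f u
                       - \sum_i (x - u) 0 i * evalp (mderiv i f) u).

Lemma sos_taylor_remD (n d : nat) (f g : mpoly n R) :
  sos_taylor_rem d f -> sos_taylor_rem d g -> sos_taylor_rem d (f + g).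
Proof.
move=> hf hg u; apply: eq_gram_rep (gram_repD (hf u) (hg u)) => x.
under [in RHS]eq_bigr => i _ do rewrite mderivD /evalp mevalD mulrDr.
rewrite big_split /evalp !mevalD /=; ring.
Qed.

Lemma sos_taylor_remZ (n d : nat) c (f : mpoly n R) : 0 <= c ->
  sos_taylor_rem d f -> sos_taylor_rem d (c *: f).
Proof.
move=> c0 hf u; apply: eq_gram_rep (gram_repZ c0 (hf u)) => x.
under [in RHS]eq_bigr => i _ do rewrite mderivZ /evalp mevalZ mulrCA.
rewrite -mulr_sumr /evalp !mevalZ; ring.
Qed.

Lemma sos_taylor_rem_sum (n d : nat) (I : Type) (r : seq I) (f : I -> mpoly n R) :
  (forall i, sos_taylor_rem d (f i)) -> sos_taylor_rem d (\sum_(i <- r) f i).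
Proof.
move=> hf; elim: r => [|i r ih]; last by rewrite big_cons; exact: sos_taylor_remD.
rewrite big_nil => u; exists 0 => [|x]; first exact: psd0.
rewrite quad0 /evalp !meval0 subrr sub0r big1 ?oppr0 // => i _.
by rewrite mderiv0 meval0 mulr0.
Qed.

Lemma sos_taylor_rem_ge (n d : nat) (f : mpoly n R) x u : sos_taylor_rem d f ->
  evalp f u + \sum_i (x - u) 0 i * evalp (mderiv i f) u <= evalp f x.
Proof. by move=> /(_ u) /(gram_rep_ge0 x); rewrite -addrA -opprD subr_ge0. Qed.

Definition sqr_norm_poly (n : nat) : mpoly n R :=
  \sum_i mpolyX R (mnm1 i) * mpolyX R (mnm1 i).

Lemma evalp_sqr_norm (n : nat) (x : 'rV[R]_n) : evalp (sqr_norm_poly n) x = dotp x x.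
Proof.
rewrite /evalp /sqr_norm_poly raddf_sum; apply: eq_bigr => i _ /=.
by rewrite mevalM mevalXU.
Qed.

Lemma evalp_deriv_sqr_norm (n : nat) (x : 'rV[R]_n) i :
  evalp (mderiv i (sqr_norm_poly n)) x = 2 * x 0 i.
Proof.
have dX j : mderiv i (mpolyX R (mnm1 j)) = (j == i)%:R.
  rewrite mderivX mnm1E; have [->|_] := eqVneq j i; last by rewrite scale0r.
  by rewrite scale1r -[X in mnm_sub X _]add0m addmK mpolyX0.
rewrite /evalp /sqr_norm_poly [mderiv i _]raddf_sum raddf_sum (bigD1 i) //= big1 => [|j /negPf ji].
  by rewrite mderivM dX eqxx mul1r mulr1 mevalD mevalXU addr0; ring.
by rewrite mderivM dX ji mul0r mulr0 addr0 meval0.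
Qed.

(** The remainder of [|x|^2] at [u] is [|x - u|^2], a sum of squares of affine polynomials. *)
Lemma sos_taylor_rem_sqr_norm (n d : nat) : sos_taylor_rem d.+1 (sqr_norm_poly n).
Proof.
move=> u.
have h i : gram_rep d.+1 (fun x => evalp (mpolyX R (mnm1 i) - mpolyC n (u 0 i)) x ^+ 2).
  by apply: gram_rep_sqr; rewrite (leq_trans (msize_shiftX _ _)).
apply: eq_gram_rep (gram_rep_sum (index_enum _) h) => x.
rewrite !evalp_sqr_norm /dotp -!sumrB; apply: eq_bigr => i _.
rewrite evalp_deriv_sqr_norm /evalp mevalB mevalXU mevalC !mxE; ring.
Qed.

(* Adding [e * |x|^2] makes [f] coercive, hence it has a minimiser, where the Taylor remainder
   exhibits it as a nonnegative constant plus a sum of squares; then [e] tends to 0. *)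
Theorem sos_of_nonneg (n d : nat) (f : mpoly n R) :
  deg_le (2 * d) f -> sos_taylor_rem d f -> (forall x, 0 <= evalp f x) ->
  gram_rep d (evalp f).
Proof.
case: d => [|d] hf sf f0.
  have g1 : gram_rep 0 (fun x : 'rV[R]_n => evalp 1 x ^+ 2).
    by apply: gram_rep_sqr; rewrite msize1.
  apply: eq_gram_rep (gram_repZ (f0 0) g1) => x.
  by rewrite (msize1_polyC hf) /evalp !mevalC ?meval1 expr1n mulr1.
apply: (gram_rep_closed (r := sqr_norm_poly n)) => // e e0; set g := f + _.
have sg : sos_taylor_rem d.+1 g.
  apply: sos_taylor_remD => //; apply: sos_taylor_remZ; first exact: ltW.
  exact: sos_taylor_rem_sqr_norm.
have gE x : evalp g x = evalp f x + e * dotp x x.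
  by rewrite /g -evalp_sqr_norm /evalp mevalD mevalZ.
have g0 x : 0 <= evalp g x by rewrite gE addr_ge0 ?mulr_ge0 ?dotp_ge0 // ltW.
pose M := evalp g 0 / e + 1.
have M1 : 1 <= M by rewrite lerDr divr_ge0 // ltW.
have M0 : 0 <= M := le_trans ler01 M1.
have [|u _ hu] := @closed_sublevel_min _ _ (evalp g) setT _ 0 closedT
    (@compact_box R n M) (@continuous_evalp R n g) I.
  move=> x _ gx i; rewrite -(ler_pXn2r (_ : 0 < 2)%N) ?nnegrE //.
  rewrite real_normK ?num_real // (le_trans (dotp_coord_le _ _)) //.
  have hM : dotp x x <= M - 1.
    rewrite /M addrK ler_pdivlMr // mulrC (le_trans _ gx) // gE lerDr //.
  by rewrite (le_trans hM) // expr2; nra.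
have du i : evalp (mderiv i g) u = 0 by apply: evalp_min_grad => x; exact: hu.
have g1 : gram_rep d.+1 (fun x : 'rV[R]_n => evalp 1 x ^+ 2).
  by apply: gram_rep_sqr; rewrite msize1.
apply: eq_gram_rep (gram_repD (sg u) (gram_repZ (g0 u) g1)) => x.
rewrite big1 => [|i _]; last by rewrite du mulr0.
by rewrite /evalp meval1 expr1n mulr1 subr0 subrK.
Qed.

End SosNonneg.

(** * Closedness and separation for conjugate epigraphs *)

Section Conjugates.
Variable R : realType.

Lemma dotpDl n (u v w : 'rV[R]_n) : dotp (u + v) w = dotp u w + dotp v w.
Proof. by rewrite /dotp -big_split; apply: eq_bigr => i _; rewrite mxE mulrDl. Qed.

Lemma dotpZl n a (u w : 'rV[R]_n) : dotp (a *: u) w = a * dotp u w.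
Proof. by rewrite /dotp mulr_sumr; apply: eq_bigr => i _; rewrite mxE mulrA. Qed.

Lemma dotpC n (u w : 'rV[R]_n) : dotp u w = dotp w u.
Proof. by apply: eq_bigr => i _; rewrite mulrC. Qed.

Lemma dotpDr n (u v w : 'rV[R]_n) : dotp w (u + v) = dotp w u + dotp w v.
Proof. by rewrite dotpC dotpDl !(dotpC w). Qed.

Lemma dotpZr n a (u w : 'rV[R]_n) : dotp w (a *: u) = a * dotp w u.
Proof. by rewrite dotpC dotpZl (dotpC w). Qed.

Lemma dotp0l n (w : 'rV[R]_n) : dotp 0 w = 0.
Proof. by rewrite /dotp big1 // => i _; rewrite mxE mul0r. Qed.

Lemma dotp_delta n (u : 'rV[R]_n) i : dotp u (delta_mx 0 i) = u 0 i.
Proof.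
rewrite /dotp (bigD1 i) //= big1 => [|j /negPf ji]; first by rewrite mxE !eqxx mulr1 addr0.
by rewrite mxE ji andbF mulr0.
Qed.

Lemma dotp_eq0 n (u : 'rV[R]_n) : dotp u u <= 0 -> u = 0.
Proof.
move=> u0; apply/rowP => i; rewrite mxE; apply/eqP; rewrite -sqrf_eq0 eq_le sqr_ge0 andbT.
exact: le_trans (dotp_coord_le _ _) u0.
Qed.

Lemma dotp_bound n (u x : 'rV[R]_n) b : (forall i, `|u 0 i| <= b) ->
  `|dotp u x| <= b * \sum_i `|x 0 i|.
Proof.
move=> hb; rewrite (le_trans (ler_norm_sum _ _ _)) // mulr_sumr.
by apply: ler_sum => i _; rewrite normrM ler_wpM2r.
Qed.

(** If [a < 0], then [t = - a / (b - a + 1)] lies in the allowed range and gives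
    [2 a + t b <= a < 0]. *)
Lemma first_variation_ge0 (a b : R) : 0 <= b ->
  (forall t, 0 < t -> t <= 1 -> 0 <= 2 * (t * a) + t ^+ 2 * b) -> 0 <= a.
Proof.
move=> b0 h; rewrite leNgt; apply/negP => a0.
have D : 0 < b - a + 1 by lra.
pose t := - a / (b - a + 1).
have tE : t * (b - a + 1) = - a by rewrite mulfVK // gt_eqF.
have t0 : 0 < t by rewrite divr_gt0 // oppr_gt0.
have t1 : t <= 1 by rewrite ler_pdivrMr // mul1r; lra.
have := h t t0 t1.
have -> : 2 * (t * a) + t ^+ 2 * b = t * (2 * a + t * b) by ring.
rewrite pmulr_rge0 //; nra.
Qed.

Lemma affine_bounded_below (a b c : R) : (forall t, 0 <= t -> c <= a + t * b) -> 0 <= b.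
Proof.
move=> h; rewrite leNgt; apply/negP => b0.
have bn : 0 < - b by rewrite oppr_gt0.
pose t := (`|a - c| + 1) / - b.
have tE : t * b = - (`|a - c| + 1) by rewrite /t -[X in _ * X]opprK mulrN mulfVK // gt_eqF.
have t0 : 0 <= t by rewrite divr_ge0 ?(ltW bn) // addr_ge0.
have := h t t0; rewrite tE; have := ler_norm (a - c); lra.
Qed.

Lemma continuous_fst (T U : topologicalType) : continuous (fst : T * U -> T).
Proof. by move=> x; exact: cvg_fst. Qed.

Lemma continuous_snd (T U : topologicalType) : continuous (snd : T * U -> U).
Proof. by move=> x; exact: cvg_snd. Qed.

Lemma continuous_compo (T U V : topologicalType) (f : T -> U) (g : U -> V) :
  continuous f -> continuous g -> continuous (fun x => g (f x)).
Proof. by move=> cf cg x; apply: continuous_comp; [exact: cf|exact: cg]. Qed.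

(** * Separating the origin from the sum of a closed cone and conjugate epigraphs *)

Section Separation.
Variables (n : nat) (T : topologicalType) (W : set T) (p : T -> 'rV[R]_n -> R).
Variable C : set ('rV[R]_n * R).
Hypotheses (cW : compact W) (clW : closed W) (W0 : W !=set0).
Hypothesis cp : forall x, continuous (p ^~ x).
Hypothesis p_conv : forall y1 y2 a b, W y1 -> W y2 -> 0 <= a -> 0 <= b -> a + b = 1 ->
  exists2 y, W y & forall x, p y x = a * p y1 x + b * p y2 x.
Hypothesis p_subgrad : forall y xi, W y ->
  exists g, forall x, p y xi + dotp g (x - xi) <= p y x.
Hypotheses (clC : closed C) (C01 : C (0, 1)).
Hypothesis CD : forall s1 s2, C s1 -> C s2 -> C (s1.1 + s2.1, s1.2 + s2.2).
Hypothesis CZ : forall t s, 0 <= t -> C s -> C (t *: s.1, t * s.2).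

(** [C] stands for the cone of affine inequalities valid on the feasible set, [K] for the feasible
    set they cut out, and [E y] for the epigraph of the conjugate of [p y]. *)
Let K := [set x | forall s, C s -> dotp s.1 x <= s.2].
Let E (y : T) (s : 'rV[R]_n * R) := forall x, dotp s.1 x - p y x <= s.2.

Hypotheses (K0 : K !=set0) (p_pos : forall x, K x -> exists2 y, W y & 0 <= p y x).

Let ZT : Type := T * ('rV[R]_n * R) * ('rV[R]_n * R).
(** Points of [C + E] are kept as triples [(y, e, c)]: this set is closed by inspection, whereas
    closedness of the sum itself would need an argument. *)
Let Z : set (T * ('rV[R]_n * R) * ('rV[R]_n * R)) :=
  [set z | [/\ W z.1.1, E z.1.1 z.1.2 & C z.2]].
Let gap (z : ZT) : 'rV[R]_n := z.2.1 + z.1.2.1.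
Let gap' (z : ZT) : R := z.2.2 + z.1.2.2.
Let N z := dotp (gap z) (gap z) + gap' z * gap' z.

Let C00 : C (0, 0).
Proof. by have := CZ (lexx 0) C01; rewrite /= scale0r mul0r. Qed.

Let E_subgrad y xi : W y -> exists g, E y (g, dotp g xi - p y xi).
Proof.
move=> Wy; have [g hg] := p_subgrad xi Wy; exists g => x /=.
have := hg x; rewrite dotpDr -scaleN1r dotpZr; lra.
Qed.

Let p_max x : exists2 y, W y & forall y', W y' -> p y' x <= p y x.
Proof.
have [|y] := @compact_EVT_max _ _ (p ^~ x) W W0 cW; first exact: continuous_subspaceT.
by rewrite inE => Wy hy; exists y => // y' Wy'; apply: hy; rewrite inE.
Qed.

Let c1 : continuous (fun z : T * ('rV[R]_n * R) * ('rV[R]_n * R) => z.1).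
Proof. exact: continuous_fst. Qed.

Let c2 : continuous (fun z : T * ('rV[R]_n * R) * ('rV[R]_n * R) => z.2).
Proof. exact: continuous_snd. Qed.

Let c11 : continuous (fun z : T * ('rV[R]_n * R) * ('rV[R]_n * R) => z.1.1).
Proof. exact: (continuous_compo c1 (@continuous_fst _ _)). Qed.

Let c12 : continuous (fun z : T * ('rV[R]_n * R) * ('rV[R]_n * R) => z.1.2).
Proof. exact: (continuous_compo c1 (@continuous_snd _ _)). Qed.

Let c12i i : continuous (fun z : T * ('rV[R]_n * R) * ('rV[R]_n * R) => z.1.2.1 0 i).
Proof.
exact: (continuous_compo (continuous_compo c12 (@continuous_fst _ _))
  (@continuous_coord R n i)).
Qed.

Let c12' : continuous (fun z : T * ('rV[R]_n * R) * ('rV[R]_n * R) => z.1.2.2).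
Proof. exact: (continuous_compo c12 (@continuous_snd _ _)). Qed.

Let c2i i : continuous (fun z : T * ('rV[R]_n * R) * ('rV[R]_n * R) => z.2.1 0 i).
Proof.
exact: (continuous_compo (continuous_compo c2 (@continuous_fst _ _)) (@continuous_coord R n i)).
Qed.

Let c2' : continuous (fun z : T * ('rV[R]_n * R) * ('rV[R]_n * R) => z.2.2).
Proof. exact: (continuous_compo c2 (@continuous_snd _ _)). Qed.

Let cN : continuous (N : T * ('rV[R]_n * R) * ('rV[R]_n * R) -> R).
Proof.
have cg' : continuous (gap' : T * ('rV[R]_n * R) * ('rV[R]_n * R) -> R).
  exact: continuous_addr.
apply: continuous_addr; last exact: continuous_mulr.
apply: continuous_sumr => i.
have cg : continuous (fun z : T * ('rV[R]_n * R) * ('rV[R]_n * R) => gap z 0 i).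
  rewrite (_ : (fun z : T * ('rV[R]_n * R) * ('rV[R]_n * R) => _) =
             fun z => z.2.1 0 i + z.1.2.1 0 i); first exact: continuous_addr.
  by apply/funext => z; rewrite mxE.
exact: continuous_mulr.
Qed.

Let clZ : closed Z.
Proof.
have -> : Z = ((fun z => z.1.1) @^-1` W `&` [set z | E z.1.1 z.1.2]) `&`
  ((fun z => z.2) @^-1` C).
  by apply/seteqP; split => z /=; [move=> [? ? ?]|move=> [[? ?] ?]].
apply: closedI; last by apply: closed_comp => // z _; exact: c2.
apply: closedI; first by apply: closed_comp => // z _; exact: c11.
apply: closed_forall => x; apply: closed_le_fun; last exact: c12'.
rewrite (_ : (fun z : T * ('rV[R]_n * R) * ('rV[R]_n * R) => _) =
   fun z => (\sum_i z.1.2.1 0 i * x 0 i) + -1 * p z.1.1 x); last first.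
  by apply/funext => z; rewrite mulN1r.
apply: continuous_addr.
  by apply: continuous_sumr => i; apply: continuous_mulr; [exact: c12i|exact: continuous_cstr].
apply: continuous_mulr; first exact: continuous_cstr.
exact: (continuous_compo c11 (@cp x)).
Qed.

(* A point [x0] of [K] controls [e'+c'] from below, and the uniform bound of the [p y] at the
   points [x0 +- delta_i] controls each coordinate of [e]. *)
Let Z_coercive (L : R) : exists M : R, forall z, Z z -> N z <= L ->
  [/\ forall i, `|z.1.2.1 0 i| <= M, `|z.1.2.2| <= M,
      forall i, `|z.2.1 0 i| <= M & `|z.2.2| <= M].
Proof.
have [x0 Kx0] := K0.
have [phi hphi] : {phi : 'rV[R]_n -> R & forall x y, W y -> p y x <= phi x}.
  apply: (@choice _ _ (fun x b => forall y, W y -> p y x <= b)) => x.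
  by have [y _ hy] := p_max x; exists (p y x).
pose Phi := `|phi x0| + \sum_i (`|phi (x0 + delta_mx 0 i)| + `|phi (x0 + -1 *: delta_mx 0 i)|).
have Phi0 : phi x0 <= Phi.
  rewrite (le_trans (ler_norm _)) // lerDl sumr_ge0 // => i _; exact: addr_ge0.
have Phii i : phi (x0 + delta_mx 0 i) <= Phi /\ phi (x0 + -1 *: delta_mx 0 i) <= Phi.
  have h : `|phi (x0 + delta_mx 0 i)| + `|phi (x0 + -1 *: delta_mx 0 i)| <= Phi.
    rewrite /Phi (bigD1 i) //= addrCA lerDl addr_ge0 // sumr_ge0 // => j _; exact: addr_ge0.
  by split; apply: le_trans h; rewrite (le_trans (ler_norm _)) // ?lerDl ?lerDr.
(* [t ^+ 2 <= L] implies [|t| <= L + 1], which avoids square roots. *)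
pose Q := L + 1; pose X := \sum_i `|x0 0 i|.
have X0 : 0 <= X by rewrite sumr_ge0.
have Phi_ge0 : 0 <= Phi by rewrite addr_ge0 // sumr_ge0 // => i _; exact: addr_ge0.
exists (Q + (Q + Q * X + Phi) + (Q + (Q + Q * X + Phi)) * X + Phi).
move=> [[y [e e']] [c c']] /= [/= Wy Ee Cc] NL.
have L0 : 0 <= L by apply: le_trans NL; rewrite addr_ge0 ?dotp_ge0 // -expr2 sqr_ge0.
have Q0 : 0 <= Q by rewrite /Q; lra.
have sq_bound (t : R) : t ^+ 2 <= L -> `|t| <= Q.
  move=> tL; rewrite -(ler_pXn2r (_ : 0 < 2)%N) ?nnegrE // real_normK ?num_real //.
  by rewrite (le_trans tL) // /Q; nra.
have ce i : `|c 0 i + e 0 i| <= Q.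
  apply: sq_bound; apply: le_trans NL; rewrite /N /gap /gap' /=.
  have := dotp_coord_le (c + e) i; rewrite mxE => h; rewrite (le_trans h) // lerDl.
  by rewrite -expr2 sqr_ge0.
have ce' : `|c' + e'| <= Q.
  by apply: sq_bound; apply: le_trans NL; rewrite /N /gap' /= -expr2 lerDr dotp_ge0.
have cx0 : dotp c x0 <= c' by exact: (Kx0 (c, c')).
have ex0 : dotp e x0 <= e' + Phi.
  by have := Ee x0 => /= h; have := hphi x0 y Wy; lra.
have cex0 : `|dotp c x0 + dotp e x0| <= Q * X.
  rewrite -dotpDl; apply: dotp_bound => i; rewrite mxE //.
(* Testing [E] at [x0 +- delta_i] bounds [+- e_i] by [e' - <e, x0> + Phi], and
   [e' <= Q - c' <= Q - <c, x0>]. *)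
have e_bound i : `|e 0 i| <= Q + Q * X + Phi.
  have := Ee (x0 + delta_mx 0 i); have := Ee (x0 + -1 *: delta_mx 0 i).
  rewrite /= !dotpDr dotpZr dotp_delta.
  have := hphi (x0 + delta_mx 0 i) y Wy; have := hphi (x0 + -1 *: delta_mx 0 i) y Wy.
  have [] := Phii i; move: cex0 ce'; rewrite !ler_norml => /andP[? ?] /andP[? ?].
  move=> ? ? ? ? ? ?; apply/andP; split; lra.
have c_bound i : `|c 0 i| <= Q + (Q + Q * X + Phi).
  by rewrite -[c 0 i](addrK (e 0 i)) (le_trans (ler_normB _ _)) // lerD.
have := dotp_bound x0 e_bound; have := dotp_bound x0 c_bound; rewrite -/X.
have B1 : 0 <= Q * X by rewrite mulr_ge0.
have B2 : 0 <= (Q + Q * X + Phi) * X by apply: mulr_ge0 => //; lra.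
have B3 : (Q + (Q + Q * X + Phi)) * X = Q * X + (Q + Q * X + Phi) * X by rewrite mulrDl.
rewrite B3; move: ((Q + Q * X + Phi) * X) B2 (Q * X) B1 cex0 e_bound c_bound {B3} => A A0 B B0.
move=> cex0 e_bound c_bound.
move: ce'; rewrite !ler_norml => /andP[? ?] /andP[? ?] /andP[? ?].
split.
- move=> i; apply: (le_trans (e_bound i)); lra.
- apply/andP; split; lra.
- move=> i; apply: (le_trans (c_bound i)); lra.
- apply/andP; split; lra.
Qed.

(* Otherwise the nearest point of [C + E] to the origin separates strictly; tilting the
   separating functional by [(x0, -1)] makes it non-vertical, and normalising it gives a point
   [xi] of [K] at which every [p y] is negative. *)
Theorem fenchel_closed_cone : exists2 y, W y & exists2 s, C s &
  forall x, s.2 <= p y x + dotp s.1 x.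
Proof.
have [y0 Wy0] := W0; have [x0 Kx0] := K0.
have [g0 Eg0] := E_subgrad 0 Wy0.
pose z0 : T * ('rV[R]_n * R) * ('rV[R]_n * R) :=
  ((y0, (g0, dotp g0 0 - p y0 0)), (0, 0)).
have Zz0 : Z z0 by split.
have [M hM] := Z_coercive (N z0).
pose box := [set v : 'rV[R]_n * R | (forall i, `|v.1 0 i| <= M) /\ `|v.2| <= M].
have cbox : compact box.
  rewrite (_ : box = [set v : 'rV[R]_n | forall i, `|v 0 i| <= M] `*` `[- M, M]%classic).
    by apply: compact_setX; [exact: compact_box|exact: segment_compact].
  by apply/seteqP; split => v [h1 h2]; split => //; move: h2; rewrite /= in_itv /= ler_norml.
have [|[[y s] c] [/= Wy Es Cc] hmin] :=
    @closed_sublevel_min R _ N Z _ z0 clZ (compact_setX (compact_setX cW cbox) cbox) cN Zz0.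
  by move=> z Zz /(hM z Zz)[? ? ? ?]; case: Zz.
have [sg sgE] : {sg | sg = c.1 + s.1} by exists (c.1 + s.1).
pose tau := c.2 + s.2.
pose delta := dotp sg sg + tau * tau.
have d_ge0 : 0 <= delta by rewrite addr_ge0 ?dotp_ge0 // -expr2 sqr_ge0.
(* First-order optimality of the nearest point [(sg, tau)]: by [p_conv] the segment to any other
   triple lifts to [Z]. *)
have variation y' s' c' : W y' -> E y' s' -> C c' ->
    delta <= dotp sg (c'.1 + s'.1) + tau * (c'.2 + s'.2).
  move=> Wy' Es' Cc'.
  have [v vE] : {v | v = c'.1 + s'.1 + -1 *: sg} by exists (c'.1 + s'.1 + -1 *: sg).
  pose r := c'.2 + s'.2 - tau.
  have : 0 <= dotp sg v + tau * r.
    apply: (@first_variation_ge0 _ (dotp v v + r * r)) => [|t t0 t1].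
      by rewrite addr_ge0 ?dotp_ge0 // -expr2 sqr_ge0.
    have t1' : 0 <= 1 - t by lra.
    have [y'' Wy'' py''] := p_conv Wy Wy' t1' (ltW t0) (subrK t 1).
    pose z1 : T * ('rV[R]_n * R) * ('rV[R]_n * R) :=
      ((y'', ((1 - t) *: s.1 + t *: s'.1, (1 - t) * s.2 + t * s'.2)),
       ((1 - t) *: c.1 + t *: c'.1, (1 - t) * c.2 + t * c'.2)).
    have Zz1 : Z z1.
      split => //=; last first.
        exact: (CD (s1 := (_, _)) (s2 := (_, _)) (CZ t1' Cc) (CZ (ltW t0) Cc')).
      move=> x /=; rewrite py'' dotpDl !dotpZl.
      have := ler_wpM2l t1' (Es x); have := ler_wpM2l (ltW t0) (Es' x); lra.
    have := hmin z1 Zz1.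
    have g1 : gap z1 = sg + t *: v.
      by apply/rowP => i; rewrite /gap vE sgE /= !mxE; ring.
    have g1' : gap' z1 = tau + t * r by rewrite /gap' /r /tau /=; ring.
    have -> : N ((y, s), c) = delta by rewrite /N /gap /gap' /delta /= -sgE.
    rewrite /N g1 g1' /delta !dotpDl !dotpDr !dotpZl !dotpZr (dotpC v sg).
    lra.
  rewrite vE /r /delta !dotpDr dotpZr; lra.
(* If the nearest point is the origin, then [s = - c] and membership in [E y] is the desired
   inequality. *)
have [d0|d_gt0] := leP delta 0.
  have sg0 : sg = 0.
    by apply: dotp_eq0; apply: le_trans d0; rewrite lerDl -expr2 sqr_ge0.
  have tau0 : tau = 0.
    apply/eqP; rewrite -sqrf_eq0 eq_le sqr_ge0 andbT expr2; apply: le_trans d0.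
    by rewrite lerDr dotp_ge0.
  exists y => //; exists c => // x; have := Es x.
  have : dotp sg x = 0 by rewrite sg0 dotp0l.
  rewrite sgE dotpDl; move: tau0; rewrite /tau; lra.
exfalso.
(* Adding arbitrarily large multiples of [c'] to [c] would otherwise break the lower bound
   [delta]. *)
have polarC c' : C c' -> 0 <= dotp sg c'.1 + tau * c'.2.
  move=> Cc'; apply: (@affine_bounded_below (dotp sg s.1 + tau * s.2) _ delta) => t t0.
  have := variation y s _ Wy Es (CZ t0 Cc') => /=; rewrite dotpDr dotpZr; lra.
have polarE y' s' : W y' -> E y' s' -> delta <= dotp sg s'.1 + tau * s'.2.
  by move=> Wy' Es'; have := variation y' s' _ Wy' Es' C00; rewrite /= !add0r.
have tau_ge0 : 0 <= tau.
  by have := polarC _ C01; rewrite /= dotpC dotp0l add0r mulr1.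
have [ym _ hym] := p_max x0; pose phi0 := `|p ym x0|.
have phi0E y' : W y' -> p y' x0 <= phi0 by move=> /hym /le_trans; apply; exact: ler_norm.
(* Chosen so that [eps * phi0 < delta]. *)
pose eps := delta / (2 * (phi0 + 1)).
have P1 : 0 < phi0 + 1 by rewrite ltr_wpDl // /phi0.
have eps0 : 0 < eps by apply: divr_gt0 => //; lra.
have epsE : eps * (phi0 + 1) = delta / 2.
  by rewrite /eps; field; rewrite gt_eqF.
pose tau' := tau + eps; have tau'0 : 0 < tau' by rewrite ltr_wpDl.
pose xi := tau'^-1 *: (-1 *: sg + eps *: x0).
have xiE u : tau' * dotp u xi = - dotp sg u + eps * dotp u x0.
  by rewrite /xi dotpZr mulrA mulfV ?gt_eqF // mul1r dotpDr !dotpZr (dotpC u sg); ring.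
have Kxi : K xi.
  move=> c' Cc'; rewrite -(ler_pM2l tau'0) xiE.
  have := polarC c' Cc'; have := ler_wpM2l (ltW eps0) (Kx0 c' Cc').
  rewrite /tau'; lra.
have [yp Wyp pyp] := p_pos Kxi.
have [g Eg] := E_subgrad xi Wyp.
(* Eliminating [sg] with [xiE] and using [Eg] at [x0] gives [delta <= eps * p yp x0 - tau' * p yp xi
   <= eps * phi0], a contradiction. *)
have := polarE _ _ Wyp Eg; have := xiE g; rewrite /=.
have := Eg x0; rewrite /= => Eg0'.
have := ler_wpM2l (ltW eps0) Eg0'; have := ler_wpM2l (ltW eps0) (phi0E _ Wyp).
have := mulr_ge0 (ltW tau'0) pyp.
rewrite /tau'.
move: (dotp g xi) (p yp xi) (dotp g x0) (p yp x0) => a b e f.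
move=> h1 h2 h3 h4 h5.
have : eps * phi0 < delta by nra.
nra.
Qed.

End Separation.
End Conjugates.

(** * Suprema of polynomials over spectrahedra *)

Section SupFunctions.
Variable R : realType.

Section SupData.
Variables (n : nat) (D : sup_data R n).

Lemma evalp_hpoly y x :
  evalp (hpoly D y) x = evalp (sd_h0 D) x + \sum_j y 0 j * evalp (sd_h D j) x.
Proof.
rewrite /evalp /hpoly mevalD raddf_sum; congr (_ + _).
by apply: eq_bigr => j _ /=; rewrite mevalZ.
Qed.

Lemma mcoeff_hpoly y a :
  mcoeff a (hpoly D y) = mcoeff a (sd_h0 D) + \sum_j y 0 j * mcoeff a (sd_h D j).
Proof.
rewrite /hpoly mcoeffD raddf_sum; congr (_ + _).
by apply: eq_bigr => j _ /=; rewrite mcoeffZ.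
Qed.

Lemma hpoly_conv y1 y2 a b : a + b = 1 ->
  hpoly D (a *: y1 + b *: y2) = a *: hpoly D y1 + b *: hpoly D y2.
Proof.
move=> ab; apply/mpolyP => m; rewrite [RHS]mcoeffD !mcoeffZ !mcoeff_hpoly !mulrDr !mulr_sumr.
rewrite addrACA -mulrDl ab mul1r -big_split; congr (_ + _); apply: eq_bigr => j _ /=.
by rewrite !mxE mulrDl !mulrA.
Qed.

Lemma continuous_hpoly x : continuous (fun y => evalp (hpoly D y) x).
Proof.
rewrite (_ : (fun y => _) = fun y : 'rV[R]_(sd_s D) =>
    evalp (sd_h0 D) x + \sum_j y 0 j * evalp (sd_h D j) x).
  apply: continuous_addr; first exact: continuous_cstr.
  apply: continuous_sumr => j; apply: continuous_mulr; last exact: continuous_cstr.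
  exact: continuous_coord.
by apply/funext => y; rewrite evalp_hpoly.
Qed.

Lemma Omega_conv y1 y2 a b : Omega D y1 -> Omega D y2 -> 0 <= a -> 0 <= b -> a + b = 1 ->
  Omega D (a *: y1 + b *: y2).
Proof.
move=> [z1 h1] [z2 h2] a0 b0 ab; exists (a *: z1 + b *: z2).
rewrite (_ : _ + _ = a *: (sd_A0 D + \sum_(j < sd_s D) y1 0 j *: sd_A D j
                  + \sum_(l < sd_p D) z1 0 l *: sd_B D l) +
   b *: (sd_A0 D + \sum_(j < sd_s D) y2 0 j *: sd_A D j
                  + \sum_(l < sd_p D) z2 0 l *: sd_B D l)).
  by apply: psdD; apply: psdZ.
rewrite !scalerDr [RHS]addrACA; congr (_ + _).
  rewrite addrACA -scalerDl ab scale1r; congr (_ + _); rewrite !scaler_sumr -big_split.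
  by apply: eq_bigr => j _; rewrite !mxE scalerDl !scalerA.
rewrite !scaler_sumr -big_split.
by apply: eq_bigr => j _; rewrite !mxE scalerDl !scalerA.
Qed.

Variable d : nat.
Hypothesis hD : sos_convex_semialg d D.

Lemma supfun_max x : exists2 y, Omega D y & supfun D x = evalp (hpoly D y) x /\
  forall y', Omega D y' -> evalp (hpoly D y') x <= supfun D x.
Proof.
case: hD => _ _ [ne cpt] _.
have [|y] := @compact_EVT_max _ _ (fun y => evalp (hpoly D y) x) (Omega D) ne cpt.
  exact/continuous_subspaceT/continuous_hpoly.
rewrite inE => Oy hy; exists y => //.
have ub : ubound [set evalp (hpoly D y') x | y' in Omega D] (evalp (hpoly D y) x).
  by move=> _ [y' Oy' <-]; apply: hy; rewrite inE.
have supE : supfun D x = evalp (hpoly D y) x.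
  apply/eqP; rewrite eq_le; apply/andP; split.
    by apply: ge_sup => //; exists (evalp (hpoly D y) x), y.
  by apply: ub_le_sup; [exists (evalp (hpoly D y) x)|exists y].
by split => // y' Oy'; rewrite supE; apply: ub; exists y'.
Qed.

Lemma supfun_ge y x : Omega D y -> evalp (hpoly D y) x <= supfun D x.
Proof. by case: (supfun_max x) => y0 _ [_ h]; exact: h. Qed.

Lemma deg_le_hpoly y : deg_le (2 * d) (hpoly D y).
Proof.
case: hD => -[h0 h] _ _ _; rewrite /deg_le /hpoly (leq_trans (msizeD_le _ _)) // geq_max h0.
by apply: msize_sum_le => j; rewrite (leq_trans (msizeZ_le _ _)) //; exact: h.
Qed.

Lemma sos_taylor_rem_hpoly y : Omega D y -> sos_taylor_rem d (hpoly D y).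
Proof.
case: hD => _ sc _ _ Oy u.
by apply: sos_taylor; [exact: deg_le_hpoly|exact: sc].
Qed.

(** Such a [lam] is a recession direction: [y0 + t *: lam] stays in [Omega] for all [t >= 0], while
    each linear form [lam_j y_j] is bounded on a compact set. *)
Lemma Omega_recession (lam : 'rV[R]_(sd_s D)) (z : 'rV[R]_(sd_p D)) :
  psd (\sum_j lam 0 j *: sd_A D j + \sum_l z 0 l *: sd_B D l) -> lam = 0.
Proof.
case: hD => _ _ [[y0 [z0 p0]] cpt] _ pl.
apply/rowP => j; rewrite [RHS]mxE.
have [||y] := @compact_EVT_max _ _ (fun y : 'rV[R]_(sd_s D) => lam 0 j * y 0 j) (Omega D) _ cpt.
- by exists y0, z0.
- apply/continuous_subspaceT/continuous_mulr; first exact: continuous_cstr.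
  exact: continuous_coord.
rewrite inE => _ hy.
have Ot t : 0 <= t -> Omega D (y0 + t *: lam).
  move=> t0; exists (z0 + t *: z).
  rewrite (_ : _ + _ = (sd_A0 D + \sum_(j < sd_s D) y0 0 j *: sd_A D j
                  + \sum_(l < sd_p D) z0 0 l *: sd_B D l) +
     t *: (\sum_j lam 0 j *: sd_A D j + \sum_l z 0 l *: sd_B D l)).
    by apply: psdD => //; exact: psdZ.
  rewrite scalerDr [RHS]addrACA !scaler_sumr; congr (_ + _).
    rewrite -[RHS]addrA -big_split; congr (_ + _).
    by apply: eq_bigr => k _; rewrite !mxE scalerDl !scalerA.
  by rewrite -big_split; apply: eq_bigr => k _; rewrite !mxE scalerDl !scalerA.
have : 0 <= - (lam 0 j * lam 0 j).
  apply: (@affine_bounded_below _ (lam 0 j * y 0 j - lam 0 j * y0 0 j) _ 0) => t t0.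
  have := hy (y0 + t *: lam); rewrite inE => /(_ (Ot t t0)); rewrite !mxE mulrDr.
  rewrite mulrCA; lra.
rewrite oppr_ge0 -expr2 => h; apply/eqP; rewrite -sqrf_eq0 eq_le h; exact: sqr_ge0.
Qed.

(** For [lam0 > 0], dividing by [lam0] gives a point of [Omega]; for [lam0 = 0], [Omega_recession]
    kills the whole term. *)
Lemma lagrangian_term_le (lam0 : R) (lam : 'rV[R]_(sd_s D)) (z : 'rV[R]_(sd_p D)) x :
  0 <= lam0 ->
  psd (lam0 *: sd_A0 D + \sum_j lam 0 j *: sd_A D j + \sum_l z 0 l *: sd_B D l) ->
  lam0 * evalp (sd_h0 D) x + \sum_j lam 0 j * evalp (sd_h D j) x <= lam0 * supfun D x.
Proof.
rewrite le_eqVlt => /orP[/eqP <-|lam_gt0].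
  rewrite scale0r add0r => /Omega_recession ->.
  by rewrite !mul0r add0r big1 // => j _; rewrite mxE mul0r.
move=> pl; have Oy : Omega D (lam0^-1 *: lam).
  exists (lam0^-1 *: z).
  rewrite (_ : _ + _ = lam0^-1 *:
      (lam0 *: sd_A0 D + \sum_j lam 0 j *: sd_A D j + \sum_l z 0 l *: sd_B D l)).
    by apply: psdZ pl; rewrite invr_ge0 ltW.
  rewrite !scalerDr scalerA mulVf ?gt_eqF // scale1r !scaler_sumr.
  by congr (_ + _ + _); apply: eq_bigr => j _; rewrite mxE scalerA.
apply: le_trans (ler_wpM2l (ltW lam_gt0) (supfun_ge x Oy)).
rewrite evalp_hpoly mulrDr lerD2l mulr_sumr; apply: ler_sum => j _.
by rewrite mxE !mulrA mulfV ?gt_eqF // mul1r.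
Qed.

End SupData.

Lemma sos_taylor_subgrad (n d : nat) (f : mpoly n R) xi : sos_taylor_rem d f ->
  exists g, forall x, evalp f xi + dotp g (x - xi) <= evalp f x.
Proof.
move=> hf; exists (\row_i evalp (mderiv i f) xi) => x.
apply: le_trans (sos_taylor_rem_ge x xi hf); rewrite lerD2l.
by apply: ler_sum => i _; rewrite mxE mulrC.
Qed.

Lemma big_ord_con_num_den (m : nat) (V : nmodType) (F : 'I_(m + 2) -> V) :
  \sum_i F i = \sum_(i < m) F (idx_con i) + (F (idx_num m) + F (idx_den m)).
Proof.
rewrite big_split_ord /=; congr (_ + _); rewrite 2!big_ord_recl big_ord0 addr0.
by congr (F _ + F _); apply: val_inj.
Qed.

Lemma ord_con_num_den_ind (m : nat) (P : 'I_(m + 2) -> Prop) :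
  (forall i, P (idx_con i)) -> P (idx_num m) -> P (idx_den m) -> forall i, P i.
Proof.
move=> hc hn hd i; case: (split_ordP i) => [j ->|j ->]; first exact: hc.
case: j => [[|[|j]] hj] //.
  by rewrite (_ : rshift m _ = idx_num m) //; exact: val_inj.
by rewrite (_ : rshift m _ = idx_den m) //; exact: val_inj.
Qed.

Definition ord_con_num_den (m : nat) (V : Type) (f : 'I_m -> V) (a b : V)
  (i : 'I_(m + 2)) : V :=
  match fintype.split i with
  | inl j => f j
  | inr j => if j == 0 then a else b
  end.

Lemma ord_con_num_denE (m : nat) (V : Type) (f : 'I_m -> V) (a b : V) :
  [/\ forall i, ord_con_num_den f a b (idx_con i) = f i,
      ord_con_num_den f a b (idx_num m) = a & ord_con_num_den f a b (idx_den m) = b].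
Proof.
split => [i||]; rewrite /ord_con_num_den.
- by rewrite (unsplitK (inl i : 'I_m + 'I_2)).
- by rewrite (unsplitK (inr 0 : 'I_m + 'I_2)).
- by rewrite (unsplitK (inr 1 : 'I_m + 'I_2)).
Qed.

End SupFunctions.

(** * Duality *)

Section Duality.
Variables (R : realType) (n m d : nat) (D : 'I_(m + 2) -> sup_data R n).
Hypothesis hD : forall i, sos_convex_semialg d (D i).

(** The aggregated polynomial is a sum of squares, hence nonnegative at [x]; it is bounded termwise
    by [lam0 i * f_i(x)], and the constraint terms are at most 0. *)
Lemma weak_duality lam0 lam z X x : @Qfeasible R n m D d lam0 lam z X -> FPset D x ->
  lam0 (idx_den m) * - supfun (D (idx_den m)) x <= supfun (D (idx_num m)) x.
Proof.
move=> [hcoef hpsd hnum [hcon hden] pX] Kx.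
have lam_ge0 : forall i, 0 <= lam0 i.
  by apply: ord_con_num_den_ind => //; rewrite hnum.
pose P := \sum_i (lam0 i *: sd_h0 (D i) + \sum_j lam i 0 j *: sd_h (D i) j).
have PX : gram_rep d (evalp P).
  apply: gram_repI pX _ _ => [|a ha].
    apply: msize_sum_le => i; have [[h0 h] _ _ _] := hD i.
    rewrite (leq_trans (msizeD_le _ _)) // geq_max (leq_trans (msizeZ_le _ _)) //=.
    by apply: msize_sum_le => j; rewrite (leq_trans (msizeZ_le _ _)) //; exact: h.
  rewrite -hcoef // raddf_sum; apply: eq_bigr => i _ /=.
  rewrite mcoeffD mcoeffZ raddf_sum; congr (_ + _).
  by apply: eq_bigr => j _ /=; rewrite mcoeffZ.
have := gram_rep_ge0 x PX.
have -> : evalp P x = \sum_i (lam0 i * evalp (sd_h0 (D i)) x +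
                              \sum_j lam i 0 j * evalp (sd_h (D i) j) x).
  rewrite /evalp raddf_sum; apply: eq_bigr => i _ /=.
  rewrite mevalD mevalZ raddf_sum; congr (_ + _).
  by apply: eq_bigr => j _ /=; rewrite mevalZ.
move=> P0.
have : 0 <= \sum_i lam0 i * supfun (D i) x.
  apply: le_trans P0 _; apply: ler_sum => i _.
  exact: (lagrangian_term_le (hD i) x (lam_ge0 i) (hpsd i)).
rewrite big_ord_con_num_den hnum mul1r.
have : \sum_(i < m) lam0 (idx_con i) * supfun (D (idx_con i)) x <= 0.
  by apply: sumr_le0 => i _; rewrite mulr_ge0_le0 //; exact: Kx.
lra.
Qed.

Lemma epi_coneP s : epi_cone D s <-> exists lam y,
  (forall i, 0 <= lam i /\ Omega (D (idx_con i)) (y i)) /\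
  forall x, dotp s.1 x - evalp (\sum_(i < m) lam i *: hpoly (D (idx_con i)) (y i)) x <= s.2.
Proof.
split=> -[lam [y [h1 h2]]]; exists lam, y; split => //.
  move=> x; rewrite -lee_fin; apply: le_trans h2.
  by apply: ereal_sup_ubound; exists x => //; rewrite EFinB.
apply: ge_ereal_sup => _ [x _ <-].
by rewrite -EFinB lee_fin.
Qed.

(** Two weighted members of a family merge into one: the total weight multiplies the member at the
    weighted average of the parameters, which lies in the convex set [Omega]. *)
Lemma epi_coneD s1 s2 : epi_cone D s1 -> epi_cone D s2 ->
  epi_cone D (s1.1 + s2.1, s1.2 + s2.2).
Proof.
move=> /epi_coneP[l1 [y1 [h1 e1]]] /epi_coneP[l2 [y2 [h2 e2]]]; apply/epi_coneP.
have H i : exists ly : R * 'rV[R]_(sd_s (D (idx_con i))),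
    [/\ 0 <= ly.1, Omega (D (idx_con i)) ly.2 &
     ly.1 *: hpoly (D (idx_con i)) ly.2 = l1 i *: hpoly (D (idx_con i)) (y1 i) +
                                          l2 i *: hpoly (D (idx_con i)) (y2 i)].
  have [[l10 Oy1] [l20 Oy2]] := (h1 i, h2 i).
  have [l0|l0] := eqVneq (l1 i + l2 i) 0.
    exists (0, y1 i); split => //=; rewrite scale0r.
    have [-> ->] : l1 i = 0 /\ l2 i = 0 by split; apply/eqP; rewrite eq_le ?l10 ?l20 andbT; lra.
    by rewrite !scale0r addr0.
  have lp : 0 < l1 i + l2 i by rewrite lt_neqAle eq_sym l0 addr_ge0.
  have ab : l1 i / (l1 i + l2 i) + l2 i / (l1 i + l2 i) = 1 by rewrite -mulrDl mulfV.
  exists (l1 i + l2 i, l1 i / (l1 i + l2 i) *: y1 i + l2 i / (l1 i + l2 i) *: y2 i).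
  split => /=; first exact: ltW.
    by apply: Omega_conv => //; apply: divr_ge0 => //; exact: ltW.
  by rewrite (hpoly_conv _ _ ab) scalerDr !scalerA !mulrA ![(l1 i + l2 i) * _]mulrC !mulfK.
exists (fun i => (projT1 (cid (H i))).1), (fun i => (projT1 (cid (H i))).2).
split=> [i|x]; first by case: (projT2 (cid (H i))).
have -> : \sum_(i < m) (projT1 (cid (H i))).1 *: hpoly (D (idx_con i)) (projT1 (cid (H i))).2 =
   \sum_(i < m) l1 i *: hpoly (D (idx_con i)) (y1 i) +
   \sum_(i < m) l2 i *: hpoly (D (idx_con i)) (y2 i).
  by rewrite -big_split; apply: eq_bigr => i _; case: (projT2 (cid (H i))).
have := e1 x; have := e2 x; rewrite /= dotpDl /evalp mevalD; lra.
Qed.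

Lemma epi_coneZ t s : 0 <= t -> epi_cone D s -> epi_cone D (t *: s.1, t * s.2).
Proof.
move=> t0 /epi_coneP[l [y [h e]]]; apply/epi_coneP.
exists (fun i => t * l i), y; split=> [i|x].
  by have [? ?] := h i; split => //; exact: mulr_ge0.
under eq_bigr do rewrite -scalerA.
by rewrite -scaler_sumr /= dotpZl /evalp mevalZ -mulrBr ler_wpM2l //; exact: e.
Qed.

Lemma epi_cone_single i y (s : 'rV[R]_n * R) : Omega (D (idx_con i)) y ->
  (forall x, dotp s.1 x - evalp (hpoly (D (idx_con i)) y) x <= s.2) -> epi_cone D s.
Proof.
move=> Oy hs; apply/epi_coneP.
have H j : exists yj, Omega (D (idx_con j)) yj /\
    (j == i)%:R *: hpoly (D (idx_con j)) yj = (j == i)%:R *: hpoly (D (idx_con i)) y.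
  have [->|_] := eqVneq j i; first by exists y.
  have [_ _ [[yj Oj] _] _] := hD (idx_con j).
  by exists yj; rewrite !scale0r.
exists (fun j => (j == i)%:R), (fun j => projT1 (cid (H j))); split=> [j|x].
  by split; [exact: ler0n|case: (projT2 (cid (H j)))].
rewrite (eq_bigr (fun j => (j == i)%:R *: hpoly (D (idx_con i)) y)) => [|j _]; last first.
  by case: (projT2 (cid (H j))).
rewrite (bigD1 i) //= big1 => [|j /negPf ->]; last by rewrite scale0r.
by rewrite eqxx scale1r addr0.
Qed.

Lemma epi_cone01 : epi_cone D (0, 1).
Proof.
apply/epi_coneP.
have H i : exists y, Omega (D (idx_con i)) y by have [_ _ [] ] := hD (idx_con i).
exists (fun=> 0), (fun i => projT1 (cid (H i))); split=> [i|x].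
  by split => //; exact: projT2 (cid (H i)).
by rewrite big1 => [|i _]; rewrite ?scale0r // /evalp meval0 /= dotp0l subr0.
Qed.

(** For the converse, a subgradient at [x] of the member attaining the supremum yields an element of
    the cone whose inequality at [x] says that this member is at most 0. *)
Lemma FPsetP x : FPset D x <-> forall s, epi_cone D s -> dotp s.1 x <= s.2.
Proof.
split=> [Kx s /epi_coneP[l [y [h e]]]|h i].
  have := e x; suff : evalp (\sum_(i < m) l i *: hpoly (D (idx_con i)) (y i)) x <= 0 by lra.
  rewrite /evalp raddf_sum; apply: sumr_le0 => i _ /=; rewrite mevalZ.
  have [l0 Oy] := h i; rewrite mulr_ge0_le0 //.
  exact: le_trans (supfun_ge (hD _) x Oy) (Kx i).
have [y Oy [-> _]] := supfun_max (hD (idx_con i)) x.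
have [g hg] := sos_taylor_subgrad x (sos_taylor_rem_hpoly (hD _) Oy).
have := h (g, dotp g x - evalp (hpoly (D (idx_con i)) y) x).
suff C : epi_cone D (g, dotp g x - evalp (hpoly (D (idx_con i)) y) x).
  by move/(_ C) => /=; lra.
apply: epi_cone_single Oy _ => x' /=; have := hg x'.
rewrite dotpDr -scaleN1r dotpZr; lra.
Qed.

Lemma strong_duality (rho : R) : closed (epi_cone D) -> FPset D !=set0 -> 0 <= rho ->
  (forall x, FPset D x ->
     0 <= supfun (D (idx_num m)) x + rho * supfun (D (idx_den m)) x) ->
  Qval D d rho.
Proof.
move=> hC hK rho0 hpos.
pose N := D (idx_num m); pose E := D (idx_den m).
have hN : sos_convex_semialg d N by exact: hD.
have hE : sos_convex_semialg d E by exact: hD.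
have [_ _ [neN cN] _] := hN; have [_ _ [neE cE] _] := hE.
pose W := Omega N `*` Omega E.
pose p (y : 'rV[R]_(sd_s N) * 'rV[R]_(sd_s E)) x :=
  evalp (hpoly N y.1 + rho *: hpoly E y.2) x.
have pE y x : p y x = evalp (hpoly N y.1) x + rho * evalp (hpoly E y.2) x.
  by rewrite /p /evalp mevalD mevalZ.
have cW : compact W by exact: compact_setX.
have clW : closed W by exact: compact_closed (@norm_hausdorff _ _) cW.
have W0 : W !=set0.
  by have [[y1 h1] [y2 h2]] := (neN, neE); exists (y1, y2).
have srP y : W y -> sos_taylor_rem d (hpoly N y.1 + rho *: hpoly E y.2).
  move=> [Oy1 Oy2]; apply: sos_taylor_remD; first exact: (sos_taylor_rem_hpoly hN Oy1).
  by apply: sos_taylor_remZ => //; exact: (sos_taylor_rem_hpoly hE Oy2).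
have cp x : continuous (p ^~ x).
  rewrite (_ : p ^~ x = fun y => evalp (hpoly N y.1) x + rho * evalp (hpoly E y.2) x).
    apply: continuous_addr.
      exact: (continuous_compo (@continuous_fst _ _) (@continuous_hpoly R n N x)).
    apply: continuous_mulr; first exact: continuous_cstr.
    exact: (continuous_compo (@continuous_snd _ _) (@continuous_hpoly R n E x)).
  by apply/funext => y; exact: pE.
have p_conv y1 y2 a b : W y1 -> W y2 -> 0 <= a -> 0 <= b -> a + b = 1 ->
    exists2 y, W y & forall x, p y x = a * p y1 x + b * p y2 x.
  move=> [W11 W12] [W21 W22] a0 b0 ab.
  exists (a *: y1.1 + b *: y2.1, a *: y1.2 + b *: y2.2).
    by split => /=; exact: Omega_conv.
  move=> x; rewrite !pE /= !hpoly_conv //.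
  move: (hpoly N _) (hpoly N _) (hpoly E _) (hpoly E _) => f1 f2 g1 g2.
  rewrite /evalp !mevalD !mevalZ; ring.
have p_sub y xi : W y -> exists g, forall x, p y xi + dotp g (x - xi) <= p y x.
  by move=> Wy; exact: (sos_taylor_subgrad xi (srP y Wy)).
have K0 : [set x | forall s, epi_cone D s -> dotp s.1 x <= s.2] !=set0.
  by have [x /FPsetP Kx] := hK; exists x.
have p_pos x : [set x | forall s, epi_cone D s -> dotp s.1 x <= s.2] x ->
    exists2 y, W y & 0 <= p y x.
  move=> /FPsetP /hpos; have [y1 Oy1 [e1 _]] := supfun_max hN x.
  have [y2 Oy2 [e2 _]] := supfun_max hE x.
  by rewrite -/N -/E e1 e2 => h; exists (y1, y2) => //; rewrite pE.
have [[y1 y2] [/= Oy1 Oy2] [s /epi_coneP[lam [y [hlam hs]]] hps]] :=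
  fenchel_closed_cone cW clW W0 cp p_conv p_sub hC epi_cone01 epi_coneD epi_coneZ K0 p_pos.
pose l := ord_con_num_den lam 1 rho.
pose q := ord_con_num_den (fun i => hpoly (D (idx_con i)) (y i)) (hpoly N y1) (hpoly E y2).
have [lc ln le] := ord_con_num_denE lam 1 rho.
have [qc qn qe] := ord_con_num_denE (fun i => hpoly (D (idx_con i)) (y i))
  (hpoly N y1) (hpoly E y2).
(* The parameter types depend on [i], so the witnesses are tied to the chosen data through the
   polynomials [q i]. *)
have H : forall i, exists yz : 'rV[R]_(sd_s (D i)) * 'rV[R]_(sd_p (D i)),
    hpoly (D i) yz.1 = q i /\
    psd (sd_A0 (D i) + \sum_j yz.1 0 j *: sd_A (D i) j + \sum_k yz.2 0 k *: sd_B (D i) k).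
  apply: ord_con_num_den_ind => [i||].
  - by have [_ [z hz]] := hlam i; exists (y i, z); rewrite /q qc.
  - by have [z hz] := Oy1; exists (y1, z); rewrite /q qn.
  - by have [z hz] := Oy2; exists (y2, z); rewrite /q qe.
pose yz i := projT1 (cid (H i)).
have l_ge0 : forall i, 0 <= l i.
  by apply: ord_con_num_den_ind => [i||]; rewrite /l ?lc ?ln ?le //; case: (hlam i).
pose P := \sum_i l i *: hpoly (D i) (yz i).1.
have PE : P = \sum_(i < m) lam i *: hpoly (D (idx_con i)) (y i) +
              (hpoly N y1 + rho *: hpoly E y2).
  rewrite /P (eq_bigr (fun i => l i *: q i)) => [|i _]; last first.
    by congr (_ *: _); case: (projT2 (cid (H i))).
  rewrite big_ord_con_num_den /l /q ln le qn qe scale1r; congr (_ + _).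
  by apply: eq_bigr => i _; rewrite lc qc.
have Pdeg : deg_le (2 * d) P.
  apply: msize_sum_le => i; rewrite (leq_trans (msizeZ_le _ _)) //.
  exact: (deg_le_hpoly (hD i)).
have srPP : sos_taylor_rem d P.
  rewrite PE; apply: sos_taylor_remD; last exact: (srP (y1, y2)).
  apply: sos_taylor_rem_sum => i; have [l0 Oy] := hlam i.
  by apply: sos_taylor_remZ => //; exact: (sos_taylor_rem_hpoly (hD _) Oy).
(* The epigraph inequality [<s, x> - L(x) <= s.2] of the constraint part [L] and the separation
   inequality [s.2 <= p(x) + <s, x>] add up to [0 <= L(x) + p(x)]. *)
have P0 x : 0 <= evalp P x.
  have -> : evalp P x = evalp (\sum_(i < m) lam i *: hpoly (D (idx_con i)) (y i)) x
      + p (y1, y2) x by rewrite PE /evalp mevalD.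
  have := hps x; have := hs x; lra.
have [X pX hX] := gram_repP (sos_of_nonneg Pdeg srPP P0).
(* Multiplying each [y] and [z] by its multiplier makes the dual constraints linear in the
   unknowns. *)
exists l, (fun i => l i *: (yz i).1), (fun i => l i *: (yz i).2), X.
split; last by rewrite /l le.
split=> [a _|i|||//].
- rewrite -hX /P raddf_sum; apply: eq_bigr => i _ /=.
  rewrite mcoeffZ mcoeff_hpoly mulrDr mulr_sumr; congr (_ + _).
  by apply: eq_bigr => j _; rewrite mxE mulrA.
- rewrite (_ : _ + _ = l i *: (sd_A0 (D i) + \sum_j (yz i).1 0 j *: sd_A (D i) j
                               + \sum_k (yz i).2 0 k *: sd_B (D i) k)).
    by apply: psdZ => //; case: (projT2 (cid (H i))).
  rewrite !scalerDr !scaler_sumr.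
  by congr (_ + _ + _); apply: eq_bigr => j _; rewrite mxE scalerA.
- by rewrite /l ln.
- by split => [i|]; exact: l_ge0.
Qed.

End Duality.

Theorem theorem3p1 (R : realType) (n m d : nat)
    (D : 'I_(m + 2) -> sup_data R n)
    (hD : forall i, sos_convex_semialg d (D i))
    (hK : FPset D !=set0)
    (hnum : forall x, FPset D x -> 0 <= supfun (D (idx_num m)) x)
    (hden : forall x, FPset D x -> 0 < - supfun (D (idx_den m)) x)
    (hC : closed (epi_cone D)) :
  ereal_inf (EFin @` FPval D) = ereal_sup (EFin @` Qval D d) /\
  exists2 v : R, Qval D d v & ereal_sup (EFin @` Qval D d) = v%:E.
Proof.
have FP0 : FPval D !=set0.
  by have [x Kx] := hK; eexists; exists x; [exact: Kx|].
have lb0 : lbound (FPval D) 0.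
  by move=> _ [x Kx <-]; rewrite divr_ge0 ?hnum // ltW // hden.
have hlb : has_lbound (FPval D) by exists 0.
pose rho := inf (FPval D).
have rho0 : 0 <= rho by exact: lb_le_inf.
have infE : ereal_inf (EFin @` FPval D) = rho%:E by exact: ereal_inf_EFin.
have Qrho : Qval D d rho.
  apply: strong_duality => // x Kx.
  (* Clearing the positive denominator in [rho <= ratio] gives the nonnegativity on the feasible set
     that strong duality asks for. *)
  have : rho <= supfun (D (idx_num m)) x / - supfun (D (idx_den m)) x.
    by apply: ge_inf => //; exists x.
  rewrite ler_pdivlMr ?hden //; lra.
have supE : ereal_sup (EFin @` Qval D d) = rho%:E.
  apply/eqP; rewrite eq_le; apply/andP; split; last by apply: ereal_sup_ubound; exists rho.
  apply: ge_ereal_sup => _ [_ [lam0 [lam [z [X [hQ ->]]]]] <-]; rewrite lee_fin.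
  apply: lb_le_inf => // _ [x Kx <-]; rewrite ler_pdivlMr ?hden //.
  exact: weak_duality hQ Kx.
by rewrite infE supE; split => //; exists rho.
Qed.
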